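(* Let the following assumptions hold: (A1) The diagonal entries $\omega_j$ of $\Omega$ form an increasing sequence of distinct real numbers, i.e., $0<\omega_1<\omega_2<\ldots$, and $c_j\neq 0$ for all $j\in\mathbb N$. (A2) There exists a constant $\kappa>0$ such that $\omega_{j+1}-\omega_j\geq\kappa$, $j=1,2,\ldots$. (A3) There exist constants $\alpha>0$, $\beta>0$, and $k_0\in\mathbb N$ such that $|c_k|\,\omega_k^{\alpha/2}\geq\beta$ for all $k\geq k_0$. Then every solution $\varepsilon(t)$, $t\ge 0$, of the system $\dot\varepsilon = A\varepsilon$ with $\varepsilon(0)\in D(A)$ satisfies the estimate $$\|\varepsilon(t)\|\leq\tilde\beta\,(t+1)^{-1/\alpha}\,\|A\varepsilon(0)\|\quad\text{for all } t\ge 0,$$ with $\tilde\beta\geq\beta$.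
   Context: Let $H=\ell^2\times\ell^2$ (complex). Let $\Omega=\mathrm{diag}(\omega_1,\omega_2,\dots)$ with $\omega_j>0$, let $(c_j)_{j\ge1}$ be a real sequence with $\sum_j c_j^2<\infty$, and let $\gamma>0$ be a gain parameter. Define $\check A=-\frac{\gamma}{2}\,(c_jc_\iota)_{j,\iota\ge1}$, i.e. $(\check A q)_j=-\frac{\gamma}{2}c_j\sum_{\iota}c_\iota q_\iota$. The operator $A$ on $H$ acting on $\varepsilon=(q,p)^\top$, $q=(q_1,q_2,\dots)^\top$, $p=(p_1,p_2,\dots)^\top$, is $$A=\begin{pmatrix}-i\Omega+\check A & \check A\\ \check A & i\Omega+\check A\end{pmatrix},$$ with domain $D(A)=\{(q,p)\in H:\sum_j\omega_j^2(|q_j|^2+|p_j|^2)<\infty\}$. The system $\dot\varepsilon=A\varepsilon$ is the observation-error dynamics (in complex coordinates $q_j=\Delta_j+i\delta_j$, $p_j=\Delta_j-i\delta_j$) of a Luenberger-type observer with gain $F=(\gamma c,0)^\top$ for the system $\dot\xi=\Omega\eta$, $\dot\eta=-\Omega\xi+B_1u$ with scalar output $y=\sum_j c_j\xi_j$. *)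

(* Defs.v *)
From Stdlib Require Import Reals.
From Coquelicot Require Import Coquelicot.
Open Scope R_scope.

(* Sequences are indexed from 0: entry j (Rocq) corresponds to index j+1 (paper). *)

(* An element of H = l^2 x l^2 is represented by the pair of complex sequences
   (q, p), encoded as a single sequence of pairs. *)
Definition Hvec := nat -> (C * C)%type.

Definition qpart (e : Hvec) : nat -> C := fun j => fst (e j).
Definition ppart (e : Hvec) : nat -> C := fun j => snd (e j).

Definition in_l2 (u : nat -> C) : Prop := ex_series (fun j => Cmod (u j) ^ 2).

Definition inH (e : Hvec) : Prop := in_l2 (qpart e) /\ in_l2 (ppart e).

Definition normH (e : Hvec) : R :=
  sqrt (Series (fun j => Cmod (fst (e j)) ^ 2 + Cmod (snd (e j)) ^ 2)).

Definition inDA (om : nat -> R) (e : Hvec) : Prop :=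
  inH e /\
  ex_series (fun j => om j ^ 2 * (Cmod (fst (e j)) ^ 2 + Cmod (snd (e j)) ^ 2)).

Definition CSeries (u : nat -> C) : C :=
  (Series (fun i => Re (u i)), Series (fun i => Im (u i))).

Definition checkA (gam : R) (c : nat -> R) (q : nat -> C) : nat -> C :=
  fun j => Cmult (RtoC (- (gam / 2) * c j)) (CSeries (fun i => Cmult (RtoC (c i)) (q i))).

(* A = [[-i Omega + checkA, checkA], [checkA, i Omega + checkA]] *)
Definition Aop (om : nat -> R) (gam : R) (c : nat -> R) (e : Hvec) : Hvec :=
  fun j =>
    (Cplus (Cplus (Cmult (Copp Ci) (Cmult (RtoC (om j)) (qpart e j)))
                  (checkA gam c (qpart e) j))
           (checkA gam c (ppart e) j),
     Cplus (checkA gam c (qpart e) j)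
           (Cplus (Cmult Ci (Cmult (RtoC (om j)) (ppart e j)))
                  (checkA gam c (ppart e) j))).

Definition Hsub (x y : Hvec) : Hvec :=
  fun j => (Cminus (fst (x j)) (fst (y j)), Cminus (snd (x j)) (snd (y j))).

Definition Hscal (a : R) (x : Hvec) : Hvec :=
  fun j => (Cmult (RtoC a) (fst (x j)), Cmult (RtoC a) (snd (x j))).

Definition is_solution (om : nat -> R) (gam : R) (c : nat -> R) (eps : R -> Hvec) : Prop :=
  forall t, 0 <= t ->
    inDA om (eps t) /\
    forall e, 0 < e -> exists delta, 0 < delta /\
      forall h, h <> 0 -> Rabs h < delta -> 0 <= t + h ->
        normH (Hsub (Hscal (/ h) (Hsub (eps (t + h)) (eps t))) (Aop om gam c (eps t))) < e.

(* Main.v *)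
Require Import Defs.
From Stdlib Require Import Reals Arith Lra Lia.
From Coquelicot Require Import Coquelicot.
Open Scope R_scope.

(* In the coordinates a = q + p, b = -i (q - p) the system reads a' = om b - gam c Y, b' = - om a
   with Y = sum_j c_j a_j, so its real and imaginary parts are two copies of one real system of
   oscillators, whose energy E = sum_j (a_j^2 + b_j^2) satisfies E' = - 2 gam Y^2.

   Let V be the bilinear form with kernel 2 om_k / (om_j^2 - om_k^2) off the diagonal and
   - 1 / (2 om_j) on it, applied to (c_j a_j) and (c_k b_k).  Without damping,
   V' = Y^2 - 1/2 sum_j c_j^2 (a_j^2 + b_j^2).  By the frequency gap the rows of the kernel are
   uniformly square summable, so V is bounded by E and the damping contributes to V' only terms
   absorbed by AM-GM.  Hence F = E + eta V is comparable to E for small eta and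
   F' <= - (eta / 4) sum_j c_j^2 (a_j^2 + b_j^2).

   By (A3) this sum dominates sum_j om_j^(-alpha) (a_j^2 + b_j^2), and interpolation against
   sum_j om_j^2 (a_j^2 + b_j^2), which is bounded by a multiple of |A eps(0)|^2, gives
   F' <= - const F^(1 + alpha/2) / |A eps(0)|^alpha; integrating this yields the rate.

   V is truncated to the first n modes, which makes it a finite sum at the price of an error that
   vanishes, uniformly in time, as n grows. *)

(** * Finite sums and series *)

(** A quadratic in [l] that is never negative has nonpositive discriminant. The minimiser [- B / D]
    exists only for [D > 0], so [D <= 0] is treated apart. Both Cauchy-Schwarz inequalities follow
    from this. *)
Lemma discriminant_le (A B D : R) :
  0 <= A -> (forall l, 0 <= A + 2 * l * B + l ^ 2 * D) -> B ^ 2 <= A * D.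
Proof.
  intros HA H.
  destruct (Rle_lt_dec D 0) as [HD|HD].
  - destruct (Req_dec B 0) as [->|HB].
    + assert (HD0 : 0 <= D).
      { apply Rnot_lt_le; intros HD0.
        pose proof (H ((A + 1) / - D + 1)) as H1.
        assert (HX : 0 < (A + 1) / - D) by (apply Rdiv_lt_0_compat; lra).
        assert (HXD : (A + 1) / - D * D = - (A + 1)) by (field; lra).
        nra. }
      nra.
    (* This [l] turns [A + 2 * l * B] into [- A - 2], while [l ^ 2 * D] is nonpositive: a
       contradiction. *)
    + pose proof (H (- (A + 1) / B)) as H1.
      replace (A + 2 * (- (A + 1) / B) * B) with (- A - 2) in H1 by (field; lra).
      assert (0 <= (- (A + 1) / B) ^ 2) by apply pow2_ge_0.
      nra.
  - pose proof (H (- B / D)) as H1.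
    replace (A + 2 * (- B / D) * B + (- B / D) ^ 2 * D) with ((A * D - B ^ 2) / D) in H1
      by (field; lra).
    assert (H2 : 0 <= (A * D - B ^ 2) / D * D) by (apply Rmult_le_pos; lra).
    replace ((A * D - B ^ 2) / D * D) with (A * D - B ^ 2) in H2 by (field; lra).
    lra.
Qed.

Lemma sum_swap (f : nat -> nat -> R) (n m : nat) :
  sum_f_R0 (fun j => sum_f_R0 (fun k => f j k) m) n =
  sum_f_R0 (fun k => sum_f_R0 (fun j => f j k) n) m.
Proof.
  induction n as [|n IH]; simpl; [reflexivity|].
  rewrite IH, <- plus_sum. reflexivity.
Qed.

Lemma sum_scal (x : R) (u : nat -> R) (n : nat) :
  sum_f_R0 (fun j => x * u j) n = x * sum_f_R0 u n.
Proof. induction n as [|n IH]; simpl; [|rewrite IH]; ring. Qed.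

(** A double sum over a square of indices sees only the symmetric part of its summand, since twice
    the sum is the sum of [h j k + h k j]. *)
Lemma sum_symmetrize (f g : nat -> nat -> R) (n : nat) :
  (forall j k, f j k + f k j = g j k + g k j) ->
  sum_f_R0 (fun j => sum_f_R0 (f j) n) n = sum_f_R0 (fun j => sum_f_R0 (g j) n) n.
Proof.
  intros H.
  assert (D : forall h : nat -> nat -> R,
    2 * sum_f_R0 (fun j => sum_f_R0 (h j) n) n =
    sum_f_R0 (fun j => sum_f_R0 (fun k => h j k + h k j) n) n).
  { intros h.
    replace (sum_f_R0 (fun j => sum_f_R0 (fun k => h j k + h k j) n) n)
      with (sum_f_R0 (fun j => sum_f_R0 (h j) n) n + sum_f_R0 (fun j => sum_f_R0 (fun k => h k j) n) n).
    - rewrite <- (sum_swap h). exact (eq_sym (Rplus_diag (sum_f_R0 (fun j => sum_f_R0 (h j) n) n))).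
    - rewrite <- plus_sum. apply sum_eq. intros j _. now rewrite <- plus_sum. }
  assert (2 * sum_f_R0 (fun j => sum_f_R0 (f j) n) n = 2 * sum_f_R0 (fun j => sum_f_R0 (g j) n) n).
  { rewrite !D. apply sum_eq; intros j _; apply sum_eq; intros k _; apply H. }
  lra.
Qed.

Lemma sum_Cauchy_Schwarz (u v : nat -> R) (n : nat) :
  (sum_f_R0 (fun j => u j * v j) n) ^ 2 <=
  sum_f_R0 (fun j => u j ^ 2) n * sum_f_R0 (fun j => v j ^ 2) n.
Proof.
  apply discriminant_le.
  - apply cond_pos_sum; intros; apply pow2_ge_0.
  - intros l.
    replace (_ + _) with (sum_f_R0 (fun j => (u j + l * v j) ^ 2) n).
    + apply cond_pos_sum; intros; apply pow2_ge_0.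
    + rewrite <- !sum_scal, <- !plus_sum. apply sum_eq; intros; ring.
Qed.

Lemma sum_kronecker (w : nat -> R) (j n : nat) : (j <= n)%nat ->
  sum_f_R0 (fun k => if Nat.eq_dec j k then w k else 0) n = w j.
Proof.
  intros Hj. induction n as [|n IH]; simpl.
  - replace j with 0%nat by lia. now destruct (Nat.eq_dec 0 0).
  - destruct (Nat.eq_dec j (S n)) as [->|Hn].
    + rewrite (sum_eq _ (fun _ => 0)).
      * rewrite sum_eq_R0 by reflexivity. ring.
      * intros k Hk. destruct (Nat.eq_dec (S n) k); [lia|reflexivity].
    + rewrite IH by lia. ring.
Qed.

Lemma is_derive_sum (f df : nat -> R -> R) (t : R) (n : nat) :
  (forall j, is_derive (f j) t (df j t)) ->
  is_derive (fun s => sum_f_R0 (fun j => f j s) n) t (sum_f_R0 (fun j => df j t) n).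
Proof.
  intros H. induction n as [|n IH]; simpl; [apply H|].
  now apply (is_derive_plus (K := R_AbsRing) (V := R_NormedModule)).
Qed.

(* Telescoping: [1/(1+d)^2 <= 1/d - 1/(d+1)] on either side of [j]. *)
Lemma sum_inv_sqr_dist (j n : nat) :
  sum_f_R0 (fun k => / (1 + Rabs (INR j - INR k)) ^ 2) n <= 3.
Proof.
  (* [phi] is a discrete primitive with values between 0 and 3 at the two ends; the constant 3 makes
     its jump from [j] to [S j] equal to 1, the term at [k = j]. *)
  set (phi := fun k => if le_lt_dec k j then / (1 + (INR j - INR k)) else 3 - / (INR k - INR j)).
  assert (Hstep : forall d, 0 < d -> / (1 + d) ^ 2 <= / d - / (1 + d)).
  { intros d Hd.
    replace (/ d - / (1 + d)) with (/ (d * (1 + d))) by (field; lra).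
    apply Rinv_le_contravar; nra. }
  assert (Hphi : forall k, / (1 + Rabs (INR j - INR k)) ^ 2 <= phi (S k) - phi k).
  { intros k. unfold phi. rewrite S_INR.
    destruct (le_lt_dec (S k) j) as [H1|H1]; destruct (le_lt_dec k j) as [H2|H2]; try lia.
    - assert (H3 : INR (S k) <= INR j) by (apply le_INR; lia).
      rewrite S_INR in H3.
      rewrite Rabs_pos_eq by lra.
      replace (1 + (INR j - (INR k + 1))) with (INR j - INR k) by ring.
      apply Hstep; lra.
    - replace k with j by lia.
      replace (INR j - INR j) with 0 by ring.
      replace (INR j + 1 - INR j) with 1 by ring.
      rewrite Rabs_R0. lra.
    - assert (H3 : INR (S j) <= INR k) by (apply le_INR; lia).
      rewrite S_INR in H3.
      rewrite Rabs_minus_sym, Rabs_pos_eq by lra.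
      replace (INR k + 1 - INR j) with (1 + (INR k - INR j)) by ring.
      pose proof (Hstep (INR k - INR j)). lra. }
  assert (Htel : sum_f_R0 (fun k => / (1 + Rabs (INR j - INR k)) ^ 2) n <= phi (S n) - phi 0%nat).
  { induction n as [|n IH]; [apply Hphi|]. rewrite tech5. pose proof (Hphi (S n)). lra. }
  assert (H0 : 0 <= phi 0%nat).
  { unfold phi. destruct (le_lt_dec 0 j); [|lia].
    apply Rlt_le, Rinv_0_lt_compat. simpl. pose proof (pos_INR j). lra. }
  assert (H1 : phi (S n) <= 3).
  { unfold phi. destruct (le_lt_dec (S n) j) as [H1|H1].
    - apply le_INR in H1. apply Rle_trans with (/ 1); [apply Rinv_le_contravar; lra|lra].
    - apply lt_INR in H1. assert (0 < / (INR (S n) - INR j)) by (apply Rinv_0_lt_compat; lra). lra. }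
  lra.
Qed.

(** * Infinite series of real numbers *)

Lemma ex_series_Rplus (u v : nat -> R) :
  ex_series u -> ex_series v -> ex_series (fun j => u j + v j).
Proof. exact (ex_series_plus (V := R_NormedModule) u v). Qed.

Lemma ex_series_Rscal (x : R) (u : nat -> R) : ex_series u -> ex_series (fun j => x * u j).
Proof. exact (ex_series_scal (V := R_NormedModule) x u). Qed.

Lemma ex_series_dominated (u v : nat -> R) :
  (forall j, Rabs (u j) <= v j) -> ex_series v -> ex_series u.
Proof. exact (ex_series_le (V := R_CompleteNormedModule) u v). Qed.

Lemma Series_nonneg (u : nat -> R) : (forall j, 0 <= u j) -> ex_series u -> 0 <= Series u.
Proof.
  intros H Hu.
  replace 0 with (Series (fun _ => 0 * 0)) by (rewrite Series_scal_l; ring).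
  apply Series_le; [|easy]. intros j. rewrite Rmult_0_l. split; [lra|apply H].
Qed.

Lemma term_le_Series (u : nat -> R) (j : nat) :
  (forall k, 0 <= u k) -> ex_series u -> u j <= Series u.
Proof.
  intros H Hu. rewrite (Series_incr_n u (S j)) by (lia || easy). simpl.
  assert (0 <= Series (fun k => u (S (j + k)))).
  { apply Series_nonneg; [intros; apply H|].
    now apply (ex_series_incr_n (V := R_NormedModule) u (S j)). }
  destruct j as [|j]; simpl in *; [lra|].
  assert (0 <= sum_f_R0 u j) by now apply cond_pos_sum. lra.
Qed.

Lemma sum_le_Series (u : nat -> R) (n : nat) :
  (forall k, 0 <= u k) -> ex_series u -> sum_f_R0 u n <= Series u.
Proof.
  intros H Hu. rewrite (Series_incr_n u (S n)) by (lia || easy). simpl.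
  assert (0 <= Series (fun k => u (S (n + k)))).
  { apply Series_nonneg; [intros; apply H|].
    now apply (ex_series_incr_n (V := R_NormedModule) u (S n)). }
  lra.
Qed.

Lemma ex_series_mult_l2 (u v : nat -> R) :
  ex_series (fun j => u j ^ 2) -> ex_series (fun j => v j ^ 2) -> ex_series (fun j => u j * v j).
Proof.
  intros Hu Hv. apply ex_series_dominated with (fun j => u j ^ 2 + v j ^ 2).
  - intros j. apply Rabs_le. pose proof (pow2_ge_0 (u j + v j)). pose proof (pow2_ge_0 (u j - v j)).
    pose proof (pow2_ge_0 (u j)). pose proof (pow2_ge_0 (v j)). split; nra.
  - now apply ex_series_Rplus.
Qed.

Lemma Series_Cauchy_Schwarz (u v : nat -> R) :
  ex_series (fun j => u j ^ 2) -> ex_series (fun j => v j ^ 2) ->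
  Series (fun j => u j * v j) ^ 2 <= Series (fun j => u j ^ 2) * Series (fun j => v j ^ 2).
Proof.
  intros Hu Hv.
  assert (Huv : ex_series (fun j => u j * v j)) by now apply ex_series_mult_l2.
  apply discriminant_le.
  - apply Series_nonneg; [intros; apply pow2_ge_0|easy].
  - intros l.
    assert (H1 : ex_series (fun j => u j ^ 2 + 2 * l * (u j * v j)))
      by (apply ex_series_Rplus; [|apply ex_series_Rscal]; easy).
    assert (H2 : ex_series (fun j => l ^ 2 * v j ^ 2)) by now apply ex_series_Rscal.
    rewrite <- !Series_scal_l, <- Series_plus, <- Series_plus; auto using ex_series_Rscal.
    apply Series_nonneg.
    + intros j. replace (_ + _) with ((u j + l * v j) ^ 2) by ring. apply pow2_ge_0.
    + now apply ex_series_Rplus.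
Qed.

Lemma Series_tail_small (u : nat -> R) (e : R) :
  ex_series u -> 0 < e -> exists n, Series (fun k => u (S n + k)%nat) < e.
Proof.
  intros Hu He.
  pose proof (Series_correct u Hu) as H.
  apply is_series_Reals in H. destruct (H e He) as [n Hn]. exists n.
  specialize (Hn n (le_n n)). unfold Rdist in Hn.
  rewrite (Series_incr_n u (S n)) in Hn by (lia || easy). simpl pred in Hn.
  apply Rabs_def2 in Hn. lra.
Qed.

Lemma Series_abs_le (u b : nat -> R) :
  (forall j, Rabs (u j) <= b j) -> ex_series b -> Rabs (Series u) <= Series b.
Proof.
  intros H Hb.
  assert (Ha : ex_series (fun j => Rabs (u j)))
    by (apply ex_series_dominated with b; [intros; rewrite Rabs_Rabsolu; apply H|easy]).
  apply Rle_trans with (1 := Series_Rabs u Ha).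
  apply Series_le; [|easy]. intros j; split; [apply Rabs_pos|apply H].
Qed.

(** * Decay from a differential inequality *)

Lemma increment_le (f df : R -> R) (K a b : R) : a <= b ->
  (forall s, a <= s <= b -> is_derive f s (df s)) -> (forall s, a <= s <= b -> df s <= K) ->
  f b - f a <= K * (b - a).
Proof.
  intros Hab Hd HK.
  destruct (MVT_gen f a b df) as [s [Hs E]].
  - rewrite Rmin_left, Rmax_right by lra. intros s Hs. apply Hd; lra.
  - rewrite Rmin_left, Rmax_right by lra. intros s Hs.
    apply continuity_pt_filterlim.
    apply (ex_derive_continuous (K := R_AbsRing) (V := R_NormedModule)).
    eexists; now apply Hd.
  - rewrite Rmin_left, Rmax_right in Hs by lra. rewrite E.
    apply Rmult_le_compat_r; [lra|now apply HK].
Qed.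

Lemma Rpower_pos (x y : R) : 0 < Rpower x y.
Proof. apply exp_pos. Qed.

Lemma Rpower_opp_antitone (x y k : R) : 0 <= k -> 0 < x <= y -> Rpower y (- k) <= Rpower x (- k).
Proof.
  intros Hk Hxy. rewrite !Rpower_Ropp.
  apply Rinv_le_contravar; [apply Rpower_pos|now apply Rle_Rpower_l].
Qed.

(* [F] solves, up to the error [rho], the inequality [F' <= - a (F/w)^(alpha/2) F], along which
   [(F/w)^(-alpha/2)] grows linearly. *)
Lemma power_decay (F dF : R -> R) (w alpha a rho delta t : R) :
  0 < w -> 0 < alpha -> 0 < a -> 0 <= rho -> 0 < delta -> 0 <= t ->
  (forall s, 0 <= s <= t -> is_derive F s (dF s)) ->
  (forall s, 0 <= s <= t -> delta <= F s) ->
  F 0 <= w ->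
  (forall s, 0 <= s <= t -> dF s <= - a * Rpower (F s / w) (alpha / 2) * F s + rho) ->
  rho * Rpower (delta / w) (- (alpha / 2)) <= a / 2 * delta ->
  F t <= w * Rpower (Rmin 1 (alpha * a / 4) * (t + 1)) (- (2 / alpha)).
Proof.
  intros Hw Halpha Ha Hrho Hdelta Ht HF Hlow HF0 HdF Hsmall.
  set (G := fun s => Rpower (F s / w) (- (alpha / 2))).
  assert (HFw : forall s, 0 <= s <= t -> 0 < F s / w)
    by (intros s Hs; apply Rdiv_lt_0_compat; [specialize (Hlow s Hs); lra|easy]).
  assert (HG : forall s, 0 <= s <= t ->
    is_derive (fun s => - G s) s (alpha / 2 * G s * dF s / F s)).
  { intros s Hs. specialize (HFw s Hs). pose proof (Hlow s Hs) as Hl.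
    unfold G, Rpower. auto_derive.
    - split; [eexists; now apply HF|]. split; [exact HFw|easy].
    - replace (Derive (fun s => F s) s) with (dF s)
        by (symmetry; apply is_derive_unique; now apply HF).
      unfold Rdiv. field. lra. }
  assert (HGK : forall s, 0 <= s <= t -> alpha / 2 * G s * dF s / F s <= - (alpha * a / 4)).
  { intros s Hs. specialize (HFw s Hs). pose proof (Hlow s Hs) as Hl.
    assert (HGs : 0 < G s) by apply Rpower_pos.
    assert (Hinv : G s * Rpower (F s / w) (alpha / 2) = 1).
    { unfold G. rewrite <- Rpower_plus, Rplus_opp_l. now apply Rpower_O. }
    assert (HGd : G s <= Rpower (delta / w) (- (alpha / 2))).
    { apply Rpower_opp_antitone; [lra|]. split; [now apply Rdiv_lt_0_compat|].
      apply Rmult_le_compat_r; [apply Rlt_le, Rinv_0_lt_compat|]; easy. }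
    (* [G] decreases in [F], so it is largest where [F] equals [delta]; there the assumption on
       [rho] lets the error consume at most half of the decay rate. *)
    assert (Hr : rho * G s <= a / 2 * F s).
    { apply Rle_trans with (a / 2 * delta).
      - eapply Rle_trans; [|exact Hsmall]. now apply Rmult_le_compat_l.
      - apply Rmult_le_compat_l; lra. }
    assert (H1 : G s * dF s <= - (a / 2) * F s).
    { apply Rle_trans with (G s * (- a * Rpower (F s / w) (alpha / 2) * F s + rho)).
      - apply Rmult_le_compat_l; [lra|now apply HdF].
      - replace (G s * (- a * Rpower (F s / w) (alpha / 2) * F s + rho))
          with (- a * (G s * Rpower (F s / w) (alpha / 2)) * F s + rho * G s) by ring.
        rewrite Hinv. lra. }
    apply Rmult_le_reg_r with (F s); [lra|].
    replace (alpha / 2 * G s * dF s / F s * F s) with (alpha / 2 * (G s * dF s)) by (field; lra).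
    apply Rle_trans with (alpha / 2 * (- (a / 2) * F s)).
    - apply Rmult_le_compat_l; lra.
    - lra. }
  pose proof (increment_le _ _ _ 0 t Ht HG HGK) as Hinc. simpl in Hinc.
  assert (HG0 : 1 <= G 0).
  { assert (H0 : 0 <= 0 <= t) by lra. specialize (HFw 0 H0).
    replace 1 with (Rpower 1 (- (alpha / 2))).
    - apply Rpower_opp_antitone; [lra|]. split; [easy|].
      apply Rmult_le_reg_r with w; [easy|]. replace (F 0 / w * w) with (F 0) by (field; lra). lra.
    - unfold Rpower. rewrite ln_1, Rmult_0_r. apply exp_0. }
  assert (Hmu : 0 < Rmin 1 (alpha * a / 4)) by (apply Rmin_glb_lt; nra).
  (* The minimum merges the initial value [1 <= G 0] and the growth rate [alpha * a / 4] into one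
     bound proportional to [t + 1]. *)
  assert (HGt : Rmin 1 (alpha * a / 4) * (t + 1) <= G t).
  { pose proof (Rmin_l 1 (alpha * a / 4)). pose proof (Rmin_r 1 (alpha * a / 4)). nra. }
  assert (Ht' : 0 <= t <= t) by lra.
  replace (F t) with (w * Rpower (G t) (- (2 / alpha))).
  - apply Rmult_le_compat_l; [lra|]. apply Rpower_opp_antitone.
    + apply Rlt_le, Rdiv_lt_0_compat; lra.
    + split; [apply Rmult_lt_0_compat; lra|easy].
  - unfold G. rewrite Rpower_mult.
    replace (- (alpha / 2) * - (2 / alpha)) with 1 by (field; lra).
    rewrite Rpower_1 by now apply HFw. field; lra.
Qed.

(** * The real system of oscillators *)

Definition rstate := nat -> (R * R)%type.

Definition sqn (p : R * R) : R := fst p ^ 2 + snd p ^ 2.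

Definition finite_energy (x : rstate) : Prop := ex_series (fun j => sqn (x j)).

Definition energy (x : rstate) : R := Series (fun j => sqn (x j)).

Definition comb (u : R) (x : rstate) (v : R) (y : rstate) : rstate :=
  fun j => (u * fst (x j) + v * fst (y j), u * snd (x j) + v * snd (y j)).

Lemma sqn_nonneg (p : R * R) : 0 <= sqn p.
Proof. unfold sqn. pose proof (pow2_ge_0 (fst p)). pose proof (pow2_ge_0 (snd p)). lra. Qed.

Lemma sqn_comb (u v : R) (x y : rstate) (j : nat) :
  sqn (comb u x v y j) <= 2 * u ^ 2 * sqn (x j) + 2 * v ^ 2 * sqn (y j).
Proof.
  unfold sqn, comb; simpl fst; simpl snd.
  pose proof (pow2_ge_0 (u * fst (x j) - v * fst (y j))).
  pose proof (pow2_ge_0 (u * snd (x j) - v * snd (y j))). nra.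
Qed.

Lemma finite_energy_comb (u v : R) (x y : rstate) :
  finite_energy x -> finite_energy y -> finite_energy (comb u x v y).
Proof.
  intros Hx Hy. unfold finite_energy.
  apply ex_series_dominated with (fun j => 2 * u ^ 2 * sqn (x j) + 2 * v ^ 2 * sqn (y j)).
  - intros j. rewrite Rabs_pos_eq by apply sqn_nonneg. apply sqn_comb.
  - apply ex_series_Rplus; now apply ex_series_Rscal.
Qed.

Lemma energy_comb (u v : R) (x y : rstate) : finite_energy x -> finite_energy y ->
  energy (comb u x v y) <= 2 * u ^ 2 * energy x + 2 * v ^ 2 * energy y.
Proof.
  intros Hx Hy. unfold energy.
  rewrite <- !Series_scal_l, <- Series_plus by now apply ex_series_Rscal.
  apply Series_le.
  - intros j; split; [apply sqn_nonneg|apply sqn_comb].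
  - apply ex_series_Rplus; now apply ex_series_Rscal.
Qed.

Lemma energy_nonneg (x : rstate) : finite_energy x -> 0 <= energy x.
Proof. intros; apply Series_nonneg; [intros; apply sqn_nonneg|easy]. Qed.

Lemma finite_energy_ext (x y : rstate) :
  (forall j, x j = y j) -> finite_energy x -> finite_energy y.
Proof. intros H; apply ex_series_ext; intros j; now rewrite H. Qed.

Lemma energy_ext (x y : rstate) : (forall j, x j = y j) -> energy x = energy y.
Proof. intros H; apply Series_ext; intros j; now rewrite H. Qed.

Lemma finite_energy_fst (x : rstate) : finite_energy x -> ex_series (fun j => fst (x j) ^ 2).
Proof.
  apply ex_series_dominated. intros j. rewrite Rabs_pos_eq by apply pow2_ge_0.
  unfold sqn. pose proof (pow2_ge_0 (snd (x j))). lra.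
Qed.

Lemma coord_lt (x : rstate) (e : R) (j : nat) : finite_energy x -> 0 < e -> energy x < e ^ 2 ->
  Rabs (fst (x j)) < e /\ Rabs (snd (x j)) < e.
Proof.
  intros Hx He H.
  pose proof (term_le_Series _ j (fun k => sqn_nonneg (x k)) Hx) as Hj.
  fold (energy x) in Hj. unfold sqn in Hj.
  pose proof (pow2_ge_0 (fst (x j))). pose proof (pow2_ge_0 (snd (x j))).
  split; apply Rnot_le_lt; intros Hle;
    pose proof (pow_incr e _ 2 (conj (Rlt_le _ _ He) Hle)) as Hp;
    rewrite pow2_abs in Hp; lra.
Qed.

Definition out (c : nat -> R) (x : rstate) : R := Series (fun j => c j * fst (x j)).

Definition gen (om : nat -> R) (gam : R) (c : nat -> R) (x : rstate) : rstate :=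
  fun j => (om j * snd (x j) - gam * c j * out c x, - (om j * fst (x j))).

(** The difference quotient minus the velocity [v], written through [comb] so that the energy bounds
    for combinations apply. *)
Definition quotient_error (X : R -> rstate) (v : rstate) (t h : R) : rstate :=
  comb (/ h) (comb 1 (X (t + h)) (-1) (X t)) (-1) v.

(* Difference quotients are two-sided even at [t = 0], so that ordinary derivatives are available
   on all of [0, +oo); the values at negative times come from [extend] below. *)
Definition trajectory (om : nat -> R) (gam : R) (c : nat -> R) (X : R -> rstate) : Prop :=
  forall t, 0 <= t ->
    finite_energy (X t) /\ finite_energy (gen om gam c (X t)) /\
    forall e, 0 < e -> exists delta, 0 < delta /\
      forall h, h <> 0 -> Rabs h < delta ->
        finite_energy (X (t + h)) /\
        energy (quotient_error X (gen om gam c (X t)) t h) < e.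

(** * Derivatives of the energy and of the coordinates *)

(** With [y = x + h * (v + r)] the defect equals [2 * x * r + h * (v + r) ^ 2]. Young's inequality
    with weight [eta] splits the first term, so that [eta] can be fixed before [r] and [h] are made
    small. *)
Lemma square_quotient (x y v h eta : R) : h <> 0 -> 0 < eta ->
  let r := / h * (1 * y + -1 * x) + -1 * v in
  Rabs ((y ^ 2 - x ^ 2) / h - 2 * (x * v)) <=
  eta * x ^ 2 + / eta * r ^ 2 + Rabs h * (2 * v ^ 2 + 2 * r ^ 2).
Proof.
  intros Hh Heta r.
  assert (Hy : y = x + h * (v + r)) by (unfold r; field; easy).
  replace ((y ^ 2 - x ^ 2) / h - 2 * (x * v)) with (2 * x * r + h * (v + r) ^ 2)
    by (rewrite Hy; field; easy).
  apply Rle_trans with (1 := Rabs_triang _ _).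
  apply Rplus_le_compat.
  - assert (Hi : eta * / eta = 1) by (field; lra).
    assert (0 < / eta) by now apply Rinv_0_lt_compat.
    pose proof (pow2_ge_0 (eta * x - r)). pose proof (pow2_ge_0 (eta * x + r)).
    assert (Hm : / eta * (eta * x - r) ^ 2 = eta * x ^ 2 + / eta * r ^ 2 - 2 * x * r) by (field; lra).
    assert (Hp : / eta * (eta * x + r) ^ 2 = eta * x ^ 2 + / eta * r ^ 2 + 2 * x * r) by (field; lra).
    assert (0 <= / eta * (eta * x - r) ^ 2) by (apply Rmult_le_pos; lra).
    assert (0 <= / eta * (eta * x + r) ^ 2) by (apply Rmult_le_pos; lra).
    apply Rabs_le; lra.
  - rewrite Rabs_mult. apply Rmult_le_compat_l; [apply Rabs_pos|].
    rewrite Rabs_pos_eq by apply pow2_ge_0. pose proof (pow2_ge_0 (v - r)). nra.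
Qed.

Lemma sqn_quotient (x y v : R * R) (h eta : R) : h <> 0 -> 0 < eta ->
  let r := (/ h * (1 * fst y + -1 * fst x) + -1 * fst v,
            / h * (1 * snd y + -1 * snd x) + -1 * snd v) in
  Rabs (/ h * (sqn y + -1 * sqn x) + -2 * (fst x * fst v + snd x * snd v)) <=
  eta * sqn x + / eta * sqn r + Rabs h * (2 * sqn v + 2 * sqn r).
Proof.
  intros Hh Heta r.
  pose proof (square_quotient (fst x) (fst y) (fst v) h eta Hh Heta) as H1.
  pose proof (square_quotient (snd x) (snd y) (snd v) h eta Hh Heta) as H2.
  cbv zeta in H1, H2. unfold sqn, r.
  replace (/ h * _ + -2 * _) with
    (((fst y ^ 2 - fst x ^ 2) / h - 2 * (fst x * fst v)) +
     ((snd y ^ 2 - snd x ^ 2) / h - 2 * (snd x * snd v))) by (field; easy).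
  apply Rle_trans with (1 := Rabs_triang _ _). simpl in *. lra.
Qed.

Section Oscillators.

Variables (om : nat -> R) (gam : R) (c : nat -> R).
Hypothesis c_l2 : ex_series (fun j => c j ^ 2).

Lemma ex_series_out (x : rstate) : finite_energy x -> ex_series (fun j => c j * fst (x j)).
Proof. intros; apply ex_series_mult_l2; [easy|now apply finite_energy_fst]. Qed.

Lemma out_comb (u v : R) (x y : rstate) : finite_energy x -> finite_energy y ->
  out c (comb u x v y) = u * out c x + v * out c y.
Proof.
  intros Hx Hy. unfold out.
  rewrite <- !Series_scal_l, <- Series_plus by now apply ex_series_Rscal, ex_series_out.
  apply Series_ext; intros j; unfold comb; simpl; ring.
Qed.

Lemma gen_comb (u v : R) (x y : rstate) (j : nat) : finite_energy x -> finite_energy y ->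
  gen om gam c (comb u x v y) j = comb u (gen om gam c x) v (gen om gam c y) j.
Proof.
  intros Hx Hy. unfold gen at 1. rewrite out_comb by easy.
  unfold comb, gen; simpl. f_equal; ring.
Qed.

(** The rotation terms cancel mode by mode; the damping terms sum to [- gam] times the output times
    itself. *)
Lemma dissipation (x : rstate) :
  Series (fun j => fst (x j) * fst (gen om gam c x j) + snd (x j) * snd (gen om gam c x j)) =
  - gam * out c x ^ 2.
Proof.
  rewrite (Series_ext _ (fun j => - gam * out c x * (c j * fst (x j)))).
  - rewrite Series_scal_l. fold (out c x). ring.
  - intros j; unfold gen; simpl; ring.
Qed.

Lemma finite_energy_quotient_error (X : R -> rstate) (v : rstate) (t h : R) :
  finite_energy (X t) -> finite_energy (X (t + h)) -> finite_energy v ->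
  finite_energy (quotient_error X v t h).
Proof. intros; now repeat apply finite_energy_comb. Qed.

(** The defect of the energy quotient is a series dominated termwise through [sqn_quotient]. The
    dominating series has three contributions, each made at most [e / 4]. *)
Lemma energy_derive (X : R -> rstate) (t : R) : trajectory om gam c X -> 0 <= t ->
  is_derive (fun s => energy (X s)) t (- 2 * gam * out c (X t) ^ 2).
Proof.
  intros HX Ht. apply is_derive_Reals. intros e He.
  destruct (HX t Ht) as [Hx [Hv HD]].
  set (x := X t) in *. set (v := gen om gam c x) in *.
  pose proof (energy_nonneg x Hx) as HE0. pose proof (energy_nonneg v Hv) as HE1.
  (* Fixed first, to give [eta * energy x <= e / 4]; the added 1 avoids division by zero. Then the
     quotient error is made small relative to [eta], and finally [h]. *)
  set (eta := e / (4 * (energy x + 1))).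
  assert (Heta : 0 < eta) by (apply Rdiv_lt_0_compat; lra).
  assert (Hetax : eta * energy x <= e / 4).
  { apply Rle_trans with (eta * (energy x + 1)); [nra|]. unfold eta. right; field; lra. }
  destruct (HD (Rmin 1 (eta * (e / 4)))) as [d [Hd HDd]]; [apply Rmin_glb_lt; nra|].
  assert (Hd' : 0 < e / (4 * (2 * energy v + 2))) by (apply Rdiv_lt_0_compat; lra).
  assert (Hmin : 0 < Rmin d (e / (4 * (2 * energy v + 2)))) by now apply Rmin_glb_lt.
  exists (mkposreal _ Hmin). simpl. intros h Hh Hlt.
  destruct (HDd h Hh) as [Hy Hr]; [apply Rlt_le_trans with (1 := Hlt), Rmin_l|].
  pose proof (finite_energy_quotient_error X v t h Hx Hy Hv) as Hrf.
  set (y := X (t + h)) in *. set (r := quotient_error X v t h) in *.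
  pose proof (energy_nonneg r Hrf) as HEr.
  assert (Hr1 : energy r < 1) by (apply Rlt_le_trans with (1 := Hr), Rmin_l).
  assert (Hr2 : / eta * energy r <= e / 4).
  { apply Rmult_le_reg_l with eta; [easy|].
    rewrite <- Rmult_assoc, Rinv_r, Rmult_1_l by lra.
    apply Rlt_le, Rlt_le_trans with (1 := Hr), Rmin_r. }
  assert (Hh3 : Rabs h * (2 * energy v + 2 * energy r) <= e / 4).
  { apply Rle_trans with (e / (4 * (2 * energy v + 2)) * (2 * energy v + 2)).
    - apply Rmult_le_compat; try lra; [apply Rabs_pos|].
      apply Rlt_le, Rlt_le_trans with (1 := Hlt), Rmin_r.
    - right; field; lra. }
  pose proof (dissipation x) as Hdis. fold v in Hdis.
  set (b := fun j => eta * sqn (x j) + / eta * sqn (r j)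
    + Rabs h * (2 * sqn (v j) + 2 * sqn (r j))).
  set (w := fun j => / h * (sqn (y j) + -1 * sqn (x j)) +
    -2 * (fst (x j) * fst (v j) + snd (x j) * snd (v j))).
  assert (Hb : ex_series b)
    by (unfold b; repeat (assumption || apply ex_series_Rplus || apply ex_series_Rscal)).
  assert (Hxv : ex_series (fun j => fst (x j) * fst (v j) + snd (x j) * snd (v j))).
  { apply ex_series_dominated with (fun j => sqn (x j) + sqn (v j)).
    - intros j. unfold sqn.
      pose proof (pow2_ge_0 (fst (x j) - fst (v j))). pose proof (pow2_ge_0 (fst (x j) + fst (v j))).
      pose proof (pow2_ge_0 (snd (x j) - snd (v j))). pose proof (pow2_ge_0 (snd (x j) + snd (v j))).
      apply Rabs_le; split; nra.
    - now apply ex_series_Rplus. }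
  assert (Hw : Series w = (energy y - energy x) / h - - 2 * gam * out c x ^ 2).
  { unfold w.
    assert (ex_series (fun j => -1 * sqn (x j))) by now apply ex_series_Rscal.
    assert (ex_series (fun j => sqn (y j) + -1 * sqn (x j))) by now apply ex_series_Rplus.
    rewrite Series_plus, !Series_scal_l, Hdis, Series_plus, Series_scal_l
      by (easy || now apply ex_series_Rscal).
    fold (energy x) (energy y). field; easy. }
  change (Rabs ((energy y - energy x) / h - - 2 * gam * out c x ^ 2) < e).
  rewrite <- Hw. apply Rle_lt_trans with (Series b).
  - apply Series_abs_le; [|easy]. intros j. unfold w, b.
    exact (sqn_quotient (x j) (y j) (v j) h eta Hh Heta).
  - unfold b.
    assert (Hs : forall z u, finite_energy z -> ex_series (fun j => u * sqn (z j)))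
      by (intros; now apply ex_series_Rscal).
    rewrite Series_plus, Series_plus, !Series_scal_l, Series_plus, !Series_scal_l;
      fold (energy x) (energy v) (energy r); try lra;
      repeat (assumption || apply ex_series_Rplus || apply ex_series_Rscal).
Qed.

Lemma coord_derive (X : R -> rstate) (t : R) (j : nat) : trajectory om gam c X -> 0 <= t ->
  is_derive (fun s => fst (X s j)) t (fst (gen om gam c (X t) j)) /\
  is_derive (fun s => snd (X s j)) t (snd (gen om gam c (X t) j)).
Proof.
  intros HX Ht. destruct (HX t Ht) as [Hx [Hv HD]].
  assert (K : forall e, 0 < e -> exists d : posreal, forall h, h <> 0 -> Rabs h < d ->
    Rabs (fst (quotient_error X (gen om gam c (X t)) t h j)) < e /\
    Rabs (snd (quotient_error X (gen om gam c (X t)) t h j)) < e).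
  { intros e He. destruct (HD (e ^ 2)) as [d [Hd HDd]]; [now apply pow_lt|].
    exists (mkposreal d Hd). intros h Hh Hlt. destruct (HDd h Hh Hlt) as [Hy Hr].
    apply coord_lt; [now apply finite_energy_quotient_error|easy|easy]. }
  split; apply is_derive_Reals; intros e He; destruct (K e He) as [d Hd];
    exists d; intros h Hh Hlt; destruct (Hd h Hh Hlt) as [H1 H2].
  - replace (_ - _) with (fst (quotient_error X (gen om gam c (X t)) t h j)); [easy|].
    unfold quotient_error, comb; simpl; field; easy.
  - replace (_ - _) with (snd (quotient_error X (gen om gam c (X t)) t h j)); [easy|].
    unfold quotient_error, comb; simpl; field; easy.
Qed.

(** * Monotone energy and the bound on the generator *)

Hypothesis gam_pos : 0 < gam.

Lemma energy_antitone (X : R -> rstate) (s t : R) : trajectory om gam c X ->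
  0 <= s <= t -> energy (X t) <= energy (X s).
Proof.
  intros HX Hst.
  enough (energy (X t) - energy (X s) <= 0 * (t - s)) by lra.
  apply increment_le with (f := fun s => energy (X s)) (df := fun s => - 2 * gam * out c (X s) ^ 2).
  - lra.
  - intros u Hu. apply energy_derive; [easy|lra].
  - intros u _. pose proof (pow2_ge_0 (out c (X u))). nra.
Qed.

(** The system is linear and autonomous, so the difference of a trajectory and its time shift is a
    trajectory. This makes energy monotonicity available for difference quotients. *)
Lemma trajectory_increment (X : R -> rstate) (h : R) : trajectory om gam c X -> 0 <= h ->
  trajectory om gam c (fun t => comb 1 (X (t + h)) (-1) (X t)).
Proof.
  intros HX Hh t Ht.
  destruct (HX t Ht) as [Hx [Hv HD]].
  destruct (HX (t + h)) as [Hx' [Hv' HD']]; [lra|].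
  assert (Hg : forall j, comb 1 (gen om gam c (X (t + h))) (-1) (gen om gam c (X t)) j =
      gen om gam c (comb 1 (X (t + h)) (-1) (X t)) j)
    by (intros j; symmetry; now apply gen_comb).
  split; [now apply finite_energy_comb|]. split.
  - now apply finite_energy_ext with (1 := Hg), finite_energy_comb.
  - intros e He.
    destruct (HD (e / 4)) as [d [Hd HDd]]; [lra|].
    destruct (HD' (e / 4)) as [d' [Hd' HDd']]; [lra|].
    exists (Rmin d d'). split; [now apply Rmin_glb_lt|].
    intros k Hk Hlt.
    destruct (HDd k Hk) as [Hy Hr]; [apply Rlt_le_trans with (1 := Hlt), Rmin_l|].
    destruct (HDd' k Hk) as [Hy' Hr']; [apply Rlt_le_trans with (1 := Hlt), Rmin_r|].
    assert (Hy'' : finite_energy (X (t + k + h)))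
      by (replace (t + k + h) with (t + h + k) by ring; easy).
    split; [now apply finite_energy_comb|].
    rewrite (energy_ext _ (comb 1 (quotient_error X (gen om gam c (X (t + h))) (t + h) k)
                                (-1) (quotient_error X (gen om gam c (X t)) t k))).
    + eapply Rle_lt_trans; [apply energy_comb|]; try (now apply finite_energy_quotient_error). lra.
    + intros j. unfold quotient_error. unfold comb at 1. rewrite <- Hg.
      replace (t + k + h) with (t + h + k) by ring.
      unfold comb; simpl. f_equal; ring.
Qed.

(** Difference quotients with a common step have nonincreasing energy and approximate [gen] at both
    times. The factor 4 comes from two uses of [energy_comb], each costing a factor 2. *)
Lemma energy_gen_bound (X : R -> rstate) (t : R) : trajectory om gam c X -> 0 <= t ->
  energy (gen om gam c (X t)) <= 4 * energy (gen om gam c (X 0)).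
Proof.
  intros HX Ht. apply le_epsilon. intros e He.
  destruct (HX t Ht) as [Hx [Hv HD]].
  destruct (HX 0) as [Hx0 [Hv0 HD0]]; [lra|].
  (* The errors at [t] and at 0 enter the final bound with factors 2 and 4, together 6. *)
  destruct (HD (e / 6)) as [d [Hd HDd]]; [lra|].
  destruct (HD0 (e / 6)) as [d0 [Hd0 HDd0]]; [lra|].
  set (h := Rmin d d0 / 2).
  assert (Hmin : 0 < Rmin d d0) by now apply Rmin_glb_lt.
  assert (Hh : 0 < h) by (unfold h; lra).
  assert (Hhd : h < Rmin d d0) by (unfold h; lra).
  destruct (HDd h) as [Hy Hr]; [lra| |].
  { rewrite Rabs_pos_eq by lra. apply Rlt_le_trans with (1 := Hhd), Rmin_l. }
  destruct (HDd0 h) as [Hy0 Hr0]; [lra| |].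
  { rewrite Rabs_pos_eq by lra. apply Rlt_le_trans with (1 := Hhd), Rmin_r. }
  set (D := fun s => comb 1 (X (s + h)) (-1) (X s)).
  assert (HDt : trajectory om gam c D) by (apply trajectory_increment; [easy|lra]).
  assert (Hmono : energy (D t) <= energy (D 0)) by (apply energy_antitone; [easy|lra]).
  set (q := fun s => comb (/ h) (D s) 0 (D s)).
  assert (Hq : forall s, energy (q s) = (/ h) ^ 2 * energy (D s)).
  { intros s. unfold energy. rewrite <- Series_scal_l. apply Series_ext; intros j.
    unfold q, sqn, comb; simpl; ring. }
  assert (Hqt : energy (q t) <= energy (q 0)).
  { rewrite !Hq. apply Rmult_le_compat_l; [apply pow2_ge_0|easy]. }
  assert (Hfq : forall s, 0 <= s -> finite_energy (q s)).
  { intros s Hs. destruct (HDt s Hs) as [HDs _]. now apply finite_energy_comb. }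
  assert (H1 : energy (gen om gam c (X t)) <= 2 * energy (q t) + 2 * (e / 6)).
  { rewrite (energy_ext _ (comb 1 (q t) (-1) (quotient_error X (gen om gam c (X t)) t h))).
    - eapply Rle_trans; [apply energy_comb|]; auto using finite_energy_quotient_error. lra.
    - intros j. unfold quotient_error, q, D, comb, gen; simpl. f_equal; ring. }
  assert (H2 : energy (q 0) <= 2 * energy (gen om gam c (X 0)) + 2 * (e / 6)).
  { rewrite (energy_ext _ (comb 1 (gen om gam c (X 0)) 1 (quotient_error X (gen om gam c (X 0)) 0 h))).
    - eapply Rle_trans; [apply energy_comb|]; auto using finite_energy_quotient_error. lra.
    - intros j. unfold quotient_error, q, D, comb, gen; simpl. f_equal; ring. }
  lra.
Qed.

End Oscillators.

(** * The Lyapunov functional *)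

Section Lyapunov.

Variables (om : nat -> R) (gam : R) (c : nat -> R) (kappa : R).
Hypothesis om_pos : forall j, 0 < om j.
Hypothesis c_l2 : ex_series (fun j => c j ^ 2).
Hypothesis gam_pos : 0 < gam.
Hypothesis kappa_pos : 0 < kappa.
Hypothesis om_step : forall j, om (S j) - om j >= kappa.

(* Chosen so that along the undamped flow [a' = om b, b' = - om a] the bilinear form
   [sum_(j,k) kernel j k (c_j a_j) (c_k b_k)] has derivative
   [(sum_j c_j a_j)^2 - 1/2 sum_j c_j^2 (a_j^2 + b_j^2)]. *)
Definition kernel (j k : nat) : R :=
  if Nat.eq_dec j k then - / (2 * om j) else 2 * om k / (om j ^ 2 - om k ^ 2).

Definition cross (n : nat) (x : rstate) : R :=
  sum_f_R0 (fun j => sum_f_R0 (fun k =>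
    kernel j k * (c j * fst (x j)) * (c k * snd (x k))) n) n.

Definition csum : R := Series (fun j => c j ^ 2).

(** Bounds the sum of squares along any row of [kernel]: the two summands cover the entries off and
    on the diagonal, and 3 comes from [sum_inv_sqr_dist]. *)
Definition kernel_bound : R := 3 * (16 / kappa ^ 2 + / (4 * om 0%nat ^ 2)).

Definition weighted (x : rstate) : R := Series (fun j => c j ^ 2 * sqn (x j)).

Definition weighted_part (n : nat) (x : rstate) : R :=
  sum_f_R0 (fun j => c j ^ 2 * sqn (x j)) n.

Definition out_part (n : nat) (x : rstate) : R := sum_f_R0 (fun j => c j * fst (x j)) n.

(** The factor of [- gam * out c x] in the derivative of [cross]. The damping in the first component
    carries a coefficient [c j], hence the second occurrence of [c j]. *)
Definition damp_part (n : nat) (x : rstate) : R :=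
  sum_f_R0 (fun j => c j * (c j * sum_f_R0 (fun k => kernel j k * (c k * snd (x k))) n)) n.

(** The sums up to [n] include the index [n], so the tail begins at [S n]. *)
Definition ctail (n : nat) : R := Series (fun k => c (S n + k)%nat ^ 2).

(** * Frequency gap and bounds for the kernel *)

Lemma om_gap_le (j k : nat) : (j <= k)%nat -> kappa * (INR k - INR j) <= om k - om j.
Proof.
  intros H. induction H as [|k H IH]; [lra|].
  rewrite S_INR. pose proof (om_step k). lra.
Qed.

Lemma om_gap (j k : nat) : kappa * Rabs (INR j - INR k) <= Rabs (om j - om k).
Proof.
  destruct (Nat.le_ge_cases j k) as [H|H]; pose proof (om_gap_le _ _ H) as Hg; apply le_INR in H.
  - rewrite Rabs_minus_sym, (Rabs_minus_sym (om j)), Rabs_pos_eq by lra.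
    eapply Rle_trans; [exact Hg|apply Rle_abs].
  - rewrite Rabs_pos_eq by lra. eapply Rle_trans; [exact Hg|apply Rle_abs].
Qed.

Lemma om_ge_first (j : nat) : om 0%nat <= om j.
Proof.
  induction j as [|j IH]; [lra|]. pose proof (om_step j). lra.
Qed.

Lemma om_sqr_diff_neq (j k : nat) : j <> k -> om j ^ 2 - om k ^ 2 <> 0.
Proof.
  intros H E. pose proof (om_gap j k) as Hg.
  pose proof (om_pos j). pose proof (om_pos k).
  replace (om j) with (om k) in Hg by nra.
  rewrite (Rminus_diag (om k)), Rabs_R0 in Hg.
  assert (0 < Rabs (INR j - INR k)).
  { apply Rabs_pos_lt. intros E'. apply H, INR_eq. lra. }
  nra.
Qed.

(** Write [d] for the index distance. Off the diagonal the factor [om j + om k] absorbs [om k],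
    leaving at most [2 / (kappa * d)]; since [d >= 1], this is at most [4 / (kappa * (1 + d))],
    whose square has constant 16. On the diagonal the smallest frequency gives the bound. *)
Lemma kernel_sqr_le (j k : nat) :
  kernel j k ^ 2 <= (16 / kappa ^ 2 + / (4 * om 0%nat ^ 2)) * / (1 + Rabs (INR j - INR k)) ^ 2.
Proof.
  assert (Hk2 : 0 < 16 / kappa ^ 2) by (apply Rdiv_lt_0_compat; [lra|now apply pow_lt]).
  assert (H02 : 0 < / (4 * om 0%nat ^ 2)).
  { apply Rinv_0_lt_compat. pose proof (pow_lt _ 2 (om_pos 0)). lra. }
  pose proof (om_pos j). pose proof (om_pos k).
  unfold kernel. destruct (Nat.eq_dec j k) as [<-|H1].
  - rewrite Rminus_diag, Rabs_R0.
    replace (/ (1 + 0) ^ 2) with 1 by field.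
    apply Rle_trans with (/ (4 * om 0%nat ^ 2)); [|lra].
    replace ((- / (2 * om j)) ^ 2) with (/ (4 * om j ^ 2)) by (field; lra).
    apply Rinv_le_contravar; [pose proof (pow_lt _ 2 (om_pos 0)); lra|].
    pose proof (om_ge_first j). pose proof (om_pos 0). nra.
  - pose proof (om_gap j k) as Hg. pose proof (om_sqr_diff_neq j k H1) as Hne.
    set (d := Rabs (INR j - INR k)) in *.
    assert (Hd : 1 <= d).
    { unfold d. destruct (Nat.lt_ge_cases j k) as [H2|H2].
      - apply le_INR in H2. rewrite S_INR in H2. rewrite Rabs_minus_sym, Rabs_pos_eq; lra.
      - assert (H3 : (S k <= j)%nat) by lia. apply le_INR in H3. rewrite S_INR in H3.
        rewrite Rabs_pos_eq; lra. }
    set (P := (om j ^ 2 - om k ^ 2) ^ 2).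
    assert (HP : 0 < P) by (apply pow2_gt_0; easy).
    assert (HP1 : om k ^ 2 * kappa ^ 2 * (1 + d) ^ 2 <= 4 * P).
    { assert (Q1 : (kappa * (1 + d)) ^ 2 <= 4 * (om j - om k) ^ 2).
      { rewrite <- (pow2_abs (om j - om k)).
        replace (4 * Rabs (om j - om k) ^ 2) with ((2 * Rabs (om j - om k)) ^ 2) by ring.
        apply pow_incr. nra. }
      assert (Q2 : om k ^ 2 <= (om j + om k) ^ 2) by (apply pow_incr; lra).
      replace (4 * P) with ((om j + om k) ^ 2 * (4 * (om j - om k) ^ 2)) by (unfold P; ring).
      replace (om k ^ 2 * kappa ^ 2 * (1 + d) ^ 2) with (om k ^ 2 * (kappa * (1 + d)) ^ 2) by ring.
      apply Rmult_le_compat; try easy; apply pow2_ge_0. }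
    replace ((2 * om k / (om j ^ 2 - om k ^ 2)) ^ 2) with (4 * om k ^ 2 / P) by (unfold P; field; easy).
    apply Rle_trans with (16 / kappa ^ 2 * / (1 + d) ^ 2).
    + apply Rmult_le_reg_r with (P * (kappa ^ 2 * (1 + d) ^ 2)).
      { apply Rmult_lt_0_compat; [easy|apply Rmult_lt_0_compat; apply pow_lt; lra]. }
      replace (4 * om k ^ 2 / P * (P * (kappa ^ 2 * (1 + d) ^ 2)))
        with (4 * (om k ^ 2 * kappa ^ 2 * (1 + d) ^ 2)) by (field; lra).
      replace (16 / kappa ^ 2 * / (1 + d) ^ 2 * (P * (kappa ^ 2 * (1 + d) ^ 2)))
        with (16 * P) by (field; lra).
      lra.
    + apply Rmult_le_compat_r; [|lra].
      apply Rlt_le, Rinv_0_lt_compat, pow_lt. lra.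
Qed.

Lemma kernel_bound_pos : 0 < kernel_bound.
Proof.
  unfold kernel_bound.
  assert (0 < 16 / kappa ^ 2) by (apply Rdiv_lt_0_compat; [lra|now apply pow_lt]).
  assert (0 < / (4 * om 0%nat ^ 2)).
  { apply Rinv_0_lt_compat. pose proof (pow_lt _ 2 (om_pos 0)). lra. }
  lra.
Qed.

Lemma kernel_row_le (j n : nat) : sum_f_R0 (fun k => kernel j k ^ 2) n <= kernel_bound.
Proof.
  eapply Rle_trans; [apply sum_growing; intros k; apply kernel_sqr_le|].
  rewrite sum_scal. pose proof kernel_bound_pos as HM. unfold kernel_bound in *.
  pose proof (sum_inv_sqr_dist j n). nra.
Qed.

Lemma csum_nonneg : 0 <= csum.
Proof. apply Series_nonneg; [intros; apply pow2_ge_0|easy]. Qed.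

(** The matrix with entries [c j * kernel j k] is Hilbert-Schmidt uniformly in [n]: its rows are
    bounded by [kernel_row_le], and summation over [j] uses square summability of [c]. *)
Lemma kernel_operator_bound (w : nat -> R) (n : nat) :
  sum_f_R0 (fun j => (c j * sum_f_R0 (fun k => kernel j k * w k) n) ^ 2) n <=
  csum * kernel_bound * sum_f_R0 (fun k => w k ^ 2) n.
Proof.
  assert (Hw : 0 <= sum_f_R0 (fun k => w k ^ 2) n)
    by (apply cond_pos_sum; intros; apply pow2_ge_0).
  apply Rle_trans with
    (sum_f_R0 (fun j => kernel_bound * sum_f_R0 (fun k => w k ^ 2) n * c j ^ 2) n).
  - apply sum_growing. intros j. rewrite Rpow_mult_distr, Rmult_comm.
    apply Rmult_le_compat_r; [apply pow2_ge_0|].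
    eapply Rle_trans; [apply sum_Cauchy_Schwarz|].
    apply Rmult_le_compat_r; [easy|apply kernel_row_le].
  - rewrite sum_scal.
    assert (sum_f_R0 (fun j => c j ^ 2) n <= csum)
      by (apply sum_le_Series; [intros; apply pow2_ge_0|easy]).
    pose proof kernel_bound_pos.
    replace (csum * kernel_bound * sum_f_R0 (fun k => w k ^ 2) n)
      with (kernel_bound * sum_f_R0 (fun k => w k ^ 2) n * csum) by ring.
    apply Rmult_le_compat_l; [apply Rmult_le_pos; lra|easy].
Qed.

Lemma sum_c_snd_le (x : rstate) (n : nat) :
  sum_f_R0 (fun k => (c k * snd (x k)) ^ 2) n <= weighted_part n x.
Proof.
  apply sum_growing. intros k. unfold sqn.
  pose proof (pow2_ge_0 (c k * fst (x k))). nra.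
Qed.

Lemma c_sqr_le (j : nat) : c j ^ 2 <= csum.
Proof. apply (term_le_Series (fun j => c j ^ 2)); [intros; apply pow2_ge_0|easy]. Qed.

Lemma weighted_part_le (x : rstate) (n : nat) : finite_energy x ->
  weighted_part n x <= csum * energy x.
Proof.
  intros Hx. apply Rle_trans with (sum_f_R0 (fun j => csum * sqn (x j)) n).
  - apply sum_growing. intros j. apply Rmult_le_compat_r; [apply sqn_nonneg|apply c_sqr_le].
  - rewrite sum_scal. apply Rmult_le_compat_l; [apply csum_nonneg|].
    apply sum_le_Series; [intros; apply sqn_nonneg|easy].
Qed.

(** The bound is by [weighted_part] rather than by the energy, so that the damping contribution can
    be absorbed into the negative term of the derivative of [cross]. *)
Lemma damp_part_sqr_le (x : rstate) (n : nat) :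
  damp_part n x ^ 2 <= csum ^ 2 * kernel_bound * weighted_part n x.
Proof.
  eapply Rle_trans; [apply sum_Cauchy_Schwarz|].
  pose proof (kernel_operator_bound (fun k => c k * snd (x k)) n) as H.
  pose proof (sum_c_snd_le x n) as H1. pose proof csum_nonneg. pose proof kernel_bound_pos.
  assert (Hcs : sum_f_R0 (fun j => c j ^ 2) n <= csum)
    by (apply sum_le_Series; [intros; apply pow2_ge_0|easy]).
  replace (csum ^ 2 * kernel_bound * weighted_part n x)
    with (csum * (csum * kernel_bound * weighted_part n x)) by ring.
  apply Rmult_le_compat; try easy.
  - apply cond_pos_sum; intros; apply pow2_ge_0.
  - apply cond_pos_sum; intros; apply pow2_ge_0.
  - eapply Rle_trans; [exact H|]. apply Rmult_le_compat_l; [apply Rmult_le_pos; lra|easy].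
Qed.

Lemma cross_le (x : rstate) (n : nat) : finite_energy x ->
  Rabs (cross n x) <= csum * (kernel_bound + 1) * energy x.
Proof.
  intros Hx. pose proof csum_nonneg. pose proof kernel_bound_pos. pose proof (energy_nonneg x Hx).
  assert (Hsq : cross n x ^ 2 <= csum ^ 2 * kernel_bound * energy x ^ 2).
  { replace (cross n x) with (sum_f_R0 (fun j => fst (x j) *
      (c j * sum_f_R0 (fun k => kernel j k * (c k * snd (x k))) n)) n).
    - eapply Rle_trans; [apply sum_Cauchy_Schwarz|].
      replace (csum ^ 2 * kernel_bound * energy x ^ 2)
        with (energy x * (csum * kernel_bound * (csum * energy x))) by ring.
      apply Rmult_le_compat.
      + apply cond_pos_sum; intros; apply pow2_ge_0.
      + apply cond_pos_sum; intros; apply pow2_ge_0.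
      + eapply Rle_trans; [|apply (sum_le_Series _ n (fun j => sqn_nonneg (x j)) Hx)].
        apply sum_growing. intros j. unfold sqn. pose proof (pow2_ge_0 (snd (x j))). lra.
      + eapply Rle_trans; [apply kernel_operator_bound|].
        apply Rmult_le_compat_l; [apply Rmult_le_pos; lra|].
        eapply Rle_trans; [apply sum_c_snd_le|now apply weighted_part_le].
    - apply sum_eq. intros j _. rewrite <- Rmult_assoc, <- sum_scal.
      apply sum_eq. intros k _. ring. }
  (* The factor [kernel_bound + 1] of the claim dominates the square root of [kernel_bound]. *)
  apply Rsqr_incr_0_var; [|repeat apply Rmult_le_pos; lra].
  rewrite <- Rsqr_abs, !Rsqr_pow2. eapply Rle_trans; [exact Hsq|].
  replace ((csum * (kernel_bound + 1) * energy x) ^ 2)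
    with (csum ^ 2 * (kernel_bound + 1) ^ 2 * energy x ^ 2) by ring.
  apply Rmult_le_compat_r; [apply pow2_ge_0|].
  apply Rmult_le_compat_l; [apply pow2_ge_0|]. nra.
Qed.

(** * Derivative of the cross term *)

(** Adding the transposed summand for [j <> k] cancels the products [v j * v k] and leaves
    [2 * u j * u k]. A diagonal entry gives [/ 2 * (u j ^ 2 - v j ^ 2)], which is [u j ^ 2] minus
    half of [u j ^ 2 + v j ^ 2]. *)
Lemma cross_identity (u v : nat -> R) (n : nat) :
  sum_f_R0 (fun j => sum_f_R0 (fun k =>
    kernel j k * (om j * v j * v k - om k * u j * u k)) n) n =
  sum_f_R0 u n ^ 2 - / 2 * sum_f_R0 (fun j => u j ^ 2 + v j ^ 2) n.
Proof.
  rewrite (sum_symmetrize _ (fun j k => u j * u k -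
    (if Nat.eq_dec j k then / 2 * (u k ^ 2 + v k ^ 2) else 0))).
  - rewrite (sum_eq _ (fun j => sum_f_R0 u n * u j + - / 2 * (u j ^ 2 + v j ^ 2))).
    + rewrite plus_sum, !sum_scal. ring.
    + intros j Hj. rewrite <- (sum_eq (fun k => u j * u k +
        -1 * (if Nat.eq_dec j k then / 2 * (u k ^ 2 + v k ^ 2) else 0))) by (intros; ring).
      rewrite plus_sum, !sum_scal, sum_kronecker by easy. ring.
  - intros j k. unfold kernel. pose proof (om_pos j). pose proof (om_pos k).
    destruct (Nat.eq_dec j k) as [<-|H1].
    + destruct (Nat.eq_dec j j) as [_|H1]; [field; lra|easy].
    + destruct (Nat.eq_dec k j) as [<-|_]; [easy|].
      pose proof (om_sqr_diff_neq j k H1). field. split; [|easy].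
      apply om_sqr_diff_neq. congruence.
Qed.

Lemma is_derive_scaled_product (f g : R -> R) (df dg k p q t : R) :
  is_derive f t df -> is_derive g t dg ->
  is_derive (fun s => k * (p * f s) * (q * g s)) t (k * p * q * (df * g t + f t * dg)).
Proof.
  intros Hf Hg. auto_derive.
  - split; [eexists; exact Hf|split; [eexists; exact Hg|easy]].
  - replace (Derive (fun s => f s) t) with df by (symmetry; now apply is_derive_unique).
    replace (Derive (fun s => g s) t) with dg by (symmetry; now apply is_derive_unique).
    ring.
Qed.

(** The rotation part of the velocity yields [cross_identity], the damping in the first component
    yields [damp_part]. *)
Lemma cross_derive (X : R -> rstate) (n : nat) (t : R) : trajectory om gam c X -> 0 <= t ->
  is_derive (fun s => cross n (X s)) t
    (out_part n (X t) ^ 2 - / 2 * weighted_part n (X t) - gam * out c (X t) * damp_part n (X t)).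
Proof.
  intros HX Ht.
  set (x := X t). set (y := out c x).
  replace (_ - _ - _) with (sum_f_R0 (fun j => sum_f_R0 (fun k => kernel j k * c j * c k *
    (fst (gen om gam c x j) * snd (x k) + fst (x j) * snd (gen om gam c x k))) n) n).
  - apply is_derive_sum with (f := fun j s => sum_f_R0 (fun k =>
      kernel j k * (c j * fst (X s j)) * (c k * snd (X s k))) n)
      (df := fun j _ => sum_f_R0 (fun k => kernel j k * c j * c k *
        (fst (gen om gam c x j) * snd (x k) + fst (x j) * snd (gen om gam c x k))) n).
    intros j.
    apply is_derive_sum with (f := fun k s =>
      kernel j k * (c j * fst (X s j)) * (c k * snd (X s k)))
      (df := fun k _ => kernel j k * c j * c k *
        (fst (gen om gam c x j) * snd (x k) + fst (x j) * snd (gen om gam c x k))).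
    intros k.
    now apply is_derive_scaled_product; apply coord_derive.
  - unfold out_part, weighted_part, damp_part.
    rewrite (sum_eq (fun j => c j ^ 2 * sqn (x j))
      (fun j => (c j * fst (x j)) ^ 2 + (c j * snd (x j)) ^ 2)) by (intros; unfold sqn; ring).
    rewrite <- (cross_identity (fun j => c j * fst (x j)) (fun j => c j * snd (x j)) n).
    unfold Rminus at 1.
    replace (- (gam * y * sum_f_R0 (fun j => c j *
        (c j * sum_f_R0 (fun k => kernel j k * (c k * snd (x k))) n)) n))
      with (- (gam * y) * sum_f_R0 (fun j => c j *
        (c j * sum_f_R0 (fun k => kernel j k * (c k * snd (x k))) n)) n) by ring.
    rewrite <- sum_scal, <- plus_sum. apply sum_eq. intros j _.
    replace (- (gam * y) * (c j * (c j * sum_f_R0 (fun k => kernel j k * (c k * snd (x k))) n)))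
      with (- (gam * y) * c j ^ 2 * sum_f_R0 (fun k => kernel j k * (c k * snd (x k))) n) by ring.
    rewrite <- sum_scal, <- plus_sum. apply sum_eq. intros k _.
    unfold gen; simpl. fold y. ring.
Qed.

(** * Truncation errors *)

Lemma ctail_nonneg (n : nat) : 0 <= ctail n.
Proof.
  apply Series_nonneg; [intros; apply pow2_ge_0|].
  now apply (ex_series_incr_n (V := R_NormedModule) (fun j => c j ^ 2) (S n)).
Qed.

Lemma energy_tail_le (x : rstate) (n : nat) : finite_energy x ->
  ex_series (fun k => sqn (x (S n + k)%nat)) /\
  Series (fun k => sqn (x (S n + k)%nat)) <= energy x.
Proof.
  intros Hx. split.
  - now apply (ex_series_incr_n (V := R_NormedModule) (fun j => sqn (x j)) (S n)).
  - unfold energy. rewrite (Series_incr_n (fun j => sqn (x j)) (S n)) by (lia || easy).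
    simpl pred.
    assert (0 <= sum_f_R0 (fun j => sqn (x j)) n) by (apply cond_pos_sum; intros; apply sqn_nonneg).
    lra.
Qed.

(** Cauchy-Schwarz on the tail. The state enters only through its energy, which does not grow along
    trajectories, so the error is uniform in time. *)
Lemma out_part_error (x : rstate) (n : nat) : finite_energy x ->
  (out c x - out_part n x) ^ 2 <= ctail n * energy x.
Proof.
  intros Hx. destruct (energy_tail_le x n Hx) as [Ht1 Ht2].
  unfold out, out_part.
  rewrite (Series_incr_n (fun j => c j * fst (x j)) (S n)) by (lia || now apply ex_series_out).
  simpl pred.
  replace (_ + _ - _) with (Series (fun k => c (S n + k)%nat * fst (x (S n + k)%nat))) by ring.
  assert (Hc : ex_series (fun k => c (S n + k)%nat ^ 2))
    by now apply (ex_series_incr_n (V := R_NormedModule) (fun j => c j ^ 2) (S n)).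
  eapply Rle_trans.
  - apply (Series_Cauchy_Schwarz (fun k => c (S n + k)%nat) (fun k => fst (x (S n + k)%nat)));
      [easy|].
    now apply (finite_energy_fst (fun k => x (S n + k)%nat)).
  - apply Rmult_le_compat_l; [apply ctail_nonneg|].
    eapply Rle_trans; [|exact Ht2]. apply Series_le; [|easy].
    intros k. unfold sqn. pose proof (pow2_ge_0 (snd (x (S n + k)%nat))).
    pose proof (pow2_ge_0 (fst (x (S n + k)%nat))). lra.
Qed.

Lemma ex_series_weighted (x : rstate) : finite_energy x -> ex_series (fun j => c j ^ 2 * sqn (x j)).
Proof.
  intros Hx. apply ex_series_dominated with (fun j => csum * sqn (x j)).
  - intros j. rewrite Rabs_pos_eq by (apply Rmult_le_pos; [apply pow2_ge_0|apply sqn_nonneg]).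
    apply Rmult_le_compat_r; [apply sqn_nonneg|apply c_sqr_le].
  - now apply ex_series_Rscal.
Qed.

Lemma weighted_part_error (x : rstate) (n : nat) : finite_energy x ->
  weighted x <= weighted_part n x + ctail n * energy x.
Proof.
  intros Hx. destruct (energy_tail_le x n Hx) as [Ht1 Ht2].
  unfold weighted, weighted_part.
  rewrite (Series_incr_n (fun j => c j ^ 2 * sqn (x j)) (S n))
    by (lia || now apply ex_series_weighted).
  apply Rplus_le_compat_l.
  apply Rle_trans with (Series (fun k => ctail n * sqn (x (S n + k)%nat))).
  - apply Series_le; [|now apply ex_series_Rscal].
    intros k. split; [apply Rmult_le_pos; [apply pow2_ge_0|apply sqn_nonneg]|].
    apply Rmult_le_compat_r; [apply sqn_nonneg|].
    apply (term_le_Series (fun k => c (S n + k)%nat ^ 2)); [intros; apply pow2_ge_0|].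
    now apply (ex_series_incr_n (V := R_NormedModule) (fun j => c j ^ 2) (S n)).
  - rewrite Series_scal_l. apply Rmult_le_compat_l; [apply ctail_nonneg|easy].
Qed.

(** * The perturbed energy and its dissipation *)

Definition lyapunov (eta : R) (n : nat) (x : rstate) : R := energy x + eta * cross n x.

Definition lyapunov_rate (eta : R) (n : nat) (x : rstate) : R :=
  - 2 * gam * out c x ^ 2 + eta * (out_part n x ^ 2 - / 2 * weighted_part n x
    - gam * out c x * damp_part n x).

Lemma lyapunov_derive (eta : R) (n : nat) (X : R -> rstate) (t : R) :
  trajectory om gam c X -> 0 <= t ->
  is_derive (fun s => lyapunov eta n (X s)) t (lyapunov_rate eta n (X t)).
Proof.
  intros HX Ht.
  apply (is_derive_plus (K := R_AbsRing) (V := R_NormedModule)).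
  - now apply energy_derive with om.
  - apply (is_derive_scal (fun s => cross n (X s))). now apply cross_derive.
Qed.

(** All terms in the squared output are absorbed by [- 2 * gam * out c x ^ 2], which is what the
    smallness of [eta] ensures. The damping term uses half of the negative [weighted_part], and a
    quarter of [eta] remains. Truncation costs at most [3 * eta] times the tail term. *)
Lemma lyapunov_rate_le (eta : R) (n : nat) (x : rstate) : finite_energy x -> 0 < eta ->
  eta * (2 + gam ^ 2 * (csum ^ 2 * kernel_bound)) <= 2 * gam ->
  lyapunov_rate eta n x <= - (eta / 4) * weighted x + 3 * eta * (ctail n * energy x).
Proof.
  intros Hx Heta Hsmall. unfold lyapunov_rate.
  pose proof (damp_part_sqr_le x n) as HD.
  pose proof (out_part_error x n Hx) as HR.
  pose proof (weighted_part_error x n Hx) as HW.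
  pose proof kernel_bound_pos as HM.
  set (y := out c x) in *. set (yn := out_part n x) in *. set (d := damp_part n x) in *.
  set (w := weighted_part n x) in *. set (T := ctail n * energy x) in *.
  set (L := csum ^ 2 * kernel_bound) in *.
  assert (HL : 0 <= L) by (apply Rmult_le_pos; [apply pow2_ge_0|lra]).
  assert (HT : 0 <= T) by (apply Rmult_le_pos; [apply ctail_nonneg|now apply energy_nonneg]).
  assert (Hw : 0 <= w).
  { apply cond_pos_sum; intros; apply Rmult_le_pos; [apply pow2_ge_0|apply sqn_nonneg]. }
  assert (H1 : yn ^ 2 <= 2 * y ^ 2 + 2 * T) by (pose proof (pow2_ge_0 (2 * y - yn)); nra).
  (* AM-GM, with [|d| <= sqrt (L w)] *)
  assert (H2 : - (gam * y * d) <= gam ^ 2 * L * y ^ 2 + / 4 * w).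
  { destruct (Req_dec L 0) as [HL0|HL0].
    - assert (d = 0) by nra. subst d. nra.
    - apply Rmult_le_reg_l with (4 * L); [lra|].
      pose proof (pow2_ge_0 (2 * gam * L * y + d)).
      nra. }
  apply Rle_trans with (- 2 * gam * y ^ 2 + eta * (2 * y ^ 2 + 2 * T - / 2 * w
    + (gam ^ 2 * L * y ^ 2 + / 4 * w))).
  - apply Rplus_le_compat_l, Rmult_le_compat_l; lra.
  - assert (eta * (2 + gam ^ 2 * L) * y ^ 2 <= 2 * gam * y ^ 2)
      by (apply Rmult_le_compat_r; [apply pow2_ge_0|easy]).
    assert (eta * weighted x <= eta * (w + T)) by (apply Rmult_le_compat_l; lra).
    assert (0 <= eta * T) by (apply Rmult_le_pos; lra).
    lra.
Qed.

Lemma lyapunov_bounds (eta : R) (n : nat) (x : rstate) : finite_energy x -> 0 < eta ->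
  eta * (2 * csum * (kernel_bound + 1)) <= 1 ->
  / 2 * energy x <= lyapunov eta n x <= 2 * energy x.
Proof.
  intros Hx Heta Hsmall. pose proof (cross_le x n Hx) as H.
  pose proof (energy_nonneg x Hx) as HE.
  assert (H1 : eta * Rabs (cross n x) <= / 2 * energy x).
  { apply Rle_trans with (eta * (csum * (kernel_bound + 1) * energy x)).
    - apply Rmult_le_compat_l; lra.
    - assert (eta * (2 * csum * (kernel_bound + 1)) * energy x <= 1 * energy x)
        by (apply Rmult_le_compat_r; easy).
      lra. }
  assert (H2 : Rabs (eta * cross n x) <= / 2 * energy x)
    by (rewrite Rabs_mult, (Rabs_pos_eq eta); lra).
  apply Rabs_le_between in H2. unfold lyapunov. lra.
Qed.

(** * Control of the graph norm by the generator *)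

Definition graph_energy (x : rstate) : R := Series (fun j => om j ^ 2 * sqn (x j)).

(** The first factor bounds [graph_energy]; the second also covers the passage to [energy], which
    costs the inverse square of the smallest frequency. *)
Definition graph_bound : R :=
  (2 + 2 * gam ^ 2 * (csum * (csum * / om 0%nat ^ 2))) * (1 + / om 0%nat ^ 2).

(** The second component of [gen] is [- (om j * fst (x j))], free of damping, so it controls [fst]
    and with it the output. *)
Lemma out_sqr_le (x : rstate) : finite_energy x -> finite_energy (gen om gam c x) ->
  out c x ^ 2 <= csum * (/ om 0%nat ^ 2 * energy (gen om gam c x)).
Proof.
  intros Hx Hg. eapply Rle_trans.
  - apply Series_Cauchy_Schwarz; [easy|now apply finite_energy_fst].
  - apply Rmult_le_compat_l; [apply csum_nonneg|].
    unfold energy. rewrite <- Series_scal_l. apply Series_le; [|now apply ex_series_Rscal].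
    intros j. split; [apply pow2_ge_0|].
    pose proof (pow_lt _ 2 (om_pos 0)) as H0.
    apply Rmult_le_reg_l with (om 0%nat ^ 2); [easy|].
    rewrite <- Rmult_assoc, Rinv_r, Rmult_1_l by lra.
    unfold sqn, gen; simpl snd.
    pose proof (pow2_ge_0 (fst (om j * snd (x j) - gam * c j * out c x, - (om j * fst (x j))))).
    apply Rle_trans with (om j ^ 2 * fst (x j) ^ 2); [|nra].
    apply Rmult_le_compat_r; [apply pow2_ge_0|].
    apply pow_incr. split; [apply Rlt_le, om_pos|apply om_ge_first].
Qed.

(** Once the output is controlled, [om j * snd (x j)] is recovered from the first component of [gen]
    by adding back the damping. *)
Lemma graph_energy_le (x : rstate) : finite_energy x -> finite_energy (gen om gam c x) ->
  ex_series (fun j => om j ^ 2 * sqn (x j)) /\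
  graph_energy x <= graph_bound * energy (gen om gam c x) /\
  energy x <= graph_bound * energy (gen om gam c x).
Proof.
  intros Hx Hg. pose proof (out_sqr_le x Hx Hg) as HY. pose proof csum_nonneg as Hc.
  pose proof (energy_nonneg _ Hg) as HG.
  pose proof (pow_lt _ 2 (om_pos 0)) as H0.
  assert (Hi : 0 < / om 0%nat ^ 2) by now apply Rinv_0_lt_compat.
  set (b := fun j => 2 * sqn (gen om gam c x j) + 2 * gam ^ 2 * out c x ^ 2 * c j ^ 2).
  assert (Hb : ex_series b)
    by (unfold b; apply ex_series_Rplus; apply ex_series_Rscal; assumption).
  assert (Hle : forall j, 0 <= om j ^ 2 * sqn (x j) <= b j).
  { intros j. split; [apply Rmult_le_pos; [apply pow2_ge_0|apply sqn_nonneg]|].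
    unfold b, sqn, gen; simpl fst; simpl snd.
    pose proof (pow2_ge_0 (om j * snd (x j) - 2 * (gam * c j * out c x))).
    pose proof (pow2_ge_0 (om j * fst (x j))). nra. }
  assert (He : ex_series (fun j => om j ^ 2 * sqn (x j))).
  { apply ex_series_dominated with b; [|easy].
    intros j. rewrite Rabs_pos_eq by apply Hle. apply Hle. }
  set (K := 2 + 2 * gam ^ 2 * (csum * (csum * / om 0%nat ^ 2))).
  assert (HK : 0 <= K).
  { unfold K. assert (0 <= 2 * gam ^ 2 * (csum * (csum * / om 0%nat ^ 2))); [|lra].
    repeat apply Rmult_le_pos; lra || nra. }
  assert (H1 : graph_energy x <= K * energy (gen om gam c x)).
  { apply Rle_trans with (Series b); [now apply Series_le|].
    unfold b. rewrite Series_plus, !Series_scal_l by (apply ex_series_Rscal; assumption).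
    fold (energy (gen om gam c x)) csum. unfold K.
    assert (2 * gam ^ 2 * csum * out c x ^ 2 <=
      2 * gam ^ 2 * csum * (csum * (/ om 0%nat ^ 2 * energy (gen om gam c x)))).
    { apply Rmult_le_compat_l; [|easy]. repeat apply Rmult_le_pos; lra || nra. }
    lra. }
  assert (H2 : energy x <= / om 0%nat ^ 2 * graph_energy x).
  { unfold graph_energy. rewrite <- Series_scal_l. apply Series_le; [|now apply ex_series_Rscal].
    intros j. split; [apply sqn_nonneg|].
    rewrite <- Rmult_assoc. rewrite <- (Rmult_1_l (sqn (x j))) at 1.
    apply Rmult_le_compat_r; [apply sqn_nonneg|].
    apply Rmult_le_reg_l with (om 0%nat ^ 2); [easy|].
    rewrite <- Rmult_assoc, Rinv_r, Rmult_1_l, Rmult_1_r by lra.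
    apply pow_incr. split; [apply Rlt_le, om_pos|apply om_ge_first]. }
  assert (HKG : 0 <= K * energy (gen om gam c x)) by now apply Rmult_le_pos.
  assert (H3 : / om 0%nat ^ 2 * graph_energy x <= / om 0%nat ^ 2 * (K * energy (gen om gam c x)))
    by (apply Rmult_le_compat_l; lra).
  split; [easy|]. unfold graph_bound. fold K.
  assert (0 <= / om 0%nat ^ 2 * (K * energy (gen om gam c x))) by (apply Rmult_le_pos; lra).
  split; lra.
Qed.

Lemma graph_bound_pos : 0 < graph_bound.
Proof.
  unfold graph_bound. pose proof csum_nonneg as Hc.
  assert (Hi : 0 < / om 0%nat ^ 2) by (apply Rinv_0_lt_compat, pow_lt, om_pos).
  assert (0 <= 2 * gam ^ 2 * (csum * (csum * / om 0%nat ^ 2)))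
    by (repeat apply Rmult_le_pos; lra || nra).
  apply Rmult_lt_0_compat; lra.
Qed.

(** * Interpolation and decay of real trajectories *)

Variables (alpha b : R).
Hypothesis alpha_pos : 0 < alpha.
Hypothesis b_pos : 0 < b.
Hypothesis c_lower : forall j, b <= c j ^ 2 * Rpower (om j) alpha.

(* Splitting the frequencies at [om^2 = z] replaces the interpolation inequality of Hoelder type. *)
Lemma weighted_lower (x : rstate) (w : R) : finite_energy x ->
  ex_series (fun j => om j ^ 2 * sqn (x j)) -> 0 < w -> graph_energy x <= w -> 0 < energy x ->
  b / 2 * Rpower (energy x / (2 * w)) (alpha / 2) * energy x <= weighted x.
Proof.
  intros Hx Hg Hw Hgw HE.
  (* With this cut [w / z] is half the energy, so the high frequencies cost exactly half of the
     lower bound. *)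
  set (z := 2 * w / energy x).
  assert (Hz : 0 < z) by (apply Rdiv_lt_0_compat; lra).
  set (P := Rpower (energy x / (2 * w)) (alpha / 2)).
  assert (HP : 0 < P) by apply Rpower_pos.
  assert (HPz : P * Rpower z (alpha / 2) = 1).
  { unfold P. rewrite Rpower_mult_distr by (try apply Rdiv_lt_0_compat; lra).
    replace (energy x / (2 * w) * z) with 1 by (unfold z; field; lra).
    unfold Rpower. rewrite ln_1, Rmult_0_r. apply exp_0. }
  assert (Hiz : 0 < / z) by now apply Rinv_0_lt_compat.
  (* [P] is the power [- alpha / 2] of [z]. Below the cut [c_lower] gives [c j ^ 2 >= b * P]; above
     it [om j ^ 2 / z] exceeds 1. *)
  assert (Hpt : forall j, b * P <= c j ^ 2 + b * P * / z * om j ^ 2).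
  { intros j. pose proof (pow2_ge_0 (c j)). pose proof (om_pos j).
    assert (HbP : 0 < b * P) by now apply Rmult_lt_0_compat.
    destruct (Rle_lt_dec (om j ^ 2) z) as [Hj|Hj].
    - assert (H1 : Rpower (om j) alpha <= Rpower z (alpha / 2)).
      { replace alpha with (2 * (alpha / 2)) at 1 by field.
        rewrite <- Rpower_mult. apply Rle_Rpower_l; [lra|].
        replace 2 with (INR 2) by reflexivity. rewrite Rpower_pow by easy.
        split; [now apply pow_lt|easy]. }
      assert (H2 : b <= c j ^ 2 * Rpower z (alpha / 2)).
      { eapply Rle_trans; [apply c_lower|]. now apply Rmult_le_compat_l. }
      assert (H3 : b * P <= c j ^ 2 * Rpower z (alpha / 2) * P) by (apply Rmult_le_compat_r; lra).
      assert (H4 : 0 <= b * P * / z * om j ^ 2)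
        by (apply Rmult_le_pos; [repeat apply Rmult_le_pos; lra|apply pow2_ge_0]).
      replace (c j ^ 2 * Rpower z (alpha / 2) * P) with (c j ^ 2 * (P * Rpower z (alpha / 2)))
        in H3 by ring.
      rewrite HPz in H3. lra.
    - assert (H1 : 1 <= / z * om j ^ 2).
      { apply Rmult_le_reg_l with z; [easy|].
        rewrite <- Rmult_assoc, Rinv_r, Rmult_1_l, Rmult_1_r by lra. lra. }
      assert (H2 : b * P * 1 <= b * P * (/ z * om j ^ 2)) by (apply Rmult_le_compat_l; lra).
      lra. }
  assert (Hs : b * P * energy x <= weighted x + b * P * / z * graph_energy x).
  { unfold energy, weighted, graph_energy. rewrite <- !Series_scal_l, <- Series_plus.
    - apply Series_le.
      + intros j. pose proof (sqn_nonneg (x j)) as Hj. split.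
        * apply Rmult_le_pos; [apply Rmult_le_pos|]; lra.
        * rewrite <- Rmult_assoc, <- Rmult_plus_distr_r.
          apply Rmult_le_compat_r; [easy|apply Hpt].
      + apply ex_series_Rplus; [now apply ex_series_weighted|now apply ex_series_Rscal].
    - now apply ex_series_weighted.
    - now apply ex_series_Rscal. }
  assert (Hgz : b * P * / z * graph_energy x <= b * P * / z * w).
  { apply Rmult_le_compat_l; [|easy]. repeat apply Rmult_le_pos; lra. }
  replace (b * P * / z * w) with (b / 2 * P * energy x) in Hgz by (unfold z; field; lra).
  lra.
Qed.

(** [power_decay] is applied on [[0, t]] to the truncated functional. The truncation index depends
    on the trajectory and on [t], but the resulting bound does not contain it, so [K] is uniform. *)
Lemma trajectory_decay : exists K, 0 < K /\ forall X, trajectory om gam c X -> forall t, 0 <= t ->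
  energy (X t) <= K * Rpower (t + 1) (- (2 / alpha)) * energy (gen om gam c (X 0)).
Proof.
  pose proof csum_nonneg as Hcs. pose proof kernel_bound_pos as HM. pose proof graph_bound_pos as HGB.
  set (L := gam ^ 2 * (csum ^ 2 * kernel_bound)).
  assert (HL : 0 <= L)
    by (apply Rmult_le_pos; [|apply Rmult_le_pos]; try apply pow2_ge_0; lra).
  set (Q := 2 * csum * (kernel_bound + 1)).
  assert (HQ : 0 <= Q) by (repeat apply Rmult_le_pos; lra).
  (* The two entries meet the smallness conditions of [lyapunov_rate_le] and [lyapunov_bounds]. *)
  set (eta := Rmin (2 * gam / (2 + L)) (/ (Q + 1))).
  assert (Heta : 0 < eta)
    by (apply Rmin_glb_lt; [apply Rdiv_lt_0_compat; lra|apply Rinv_0_lt_compat; lra]).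
  assert (Heta1 : eta * (2 + L) <= 2 * gam).
  { apply Rle_trans with (2 * gam / (2 + L) * (2 + L)).
    - apply Rmult_le_compat_r; [lra|apply Rmin_l].
    - right; field; lra. }
  assert (Heta2 : eta * Q <= 1).
  { apply Rle_trans with (/ (Q + 1) * (Q + 1)).
    - apply Rmult_le_compat; try lra; apply Rmin_r.
    - right; field; lra. }
  (* The product of [eta / 4] from the dissipation, [b / 2] from [weighted_lower] and [/ 2] from
     replacing the energy by the functional. *)
  set (a := eta * b / 16).
  assert (Ha : 0 < a) by (unfold a; nra).
  set (mu := Rmin 1 (alpha * a / 4)).
  assert (Hmu : 0 < mu) by (apply Rmin_glb_lt; nra).
  exists (2 * (4 * (4 * graph_bound)) * Rpower mu (- (2 / alpha))).
  split; [apply Rmult_lt_0_compat; [lra|apply Rpower_pos]|].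
  intros X HX t Ht.
  assert (Hfin : forall s, 0 <= s -> finite_energy (X s)) by (intros s Hs; now apply HX).
  assert (H00 : 0 <= 0) by lra.
  destruct (HX 0 H00) as [Hx0 [Hg0 _]].
  set (n2 := energy (gen om gam c (X 0))) in *.
  assert (Hn2 : 0 <= n2) by now apply energy_nonneg.
  pose proof (Rpower_pos mu (- (2 / alpha))) as Hpm.
  pose proof (Rpower_pos (t + 1) (- (2 / alpha))) as Hpt.
  (* Zero energy at time [t] is trivial; otherwise monotonicity bounds the energy on [[0, t]] below
     by a positive number. *)
  destruct (energy_nonneg (X t) (Hfin t Ht)) as [HEt|HEt].
  2: { rewrite <- HEt. apply Rmult_le_pos; [apply Rmult_le_pos; [apply Rmult_le_pos|]|]; lra. }
  assert (HE : forall s, 0 <= s <= t -> energy (X t) <= energy (X s) <= energy (X 0)).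
  { intros s Hs. split; eapply energy_antitone with (om := om) (gam := gam) (c := c);
      try eassumption; lra. }
  destruct (graph_energy_le (X 0) Hx0 Hg0) as [_ [_ HE0]]. fold n2 in HE0.
  assert (HE0t : energy (X t) <= energy (X 0)) by (apply HE; lra).
  set (w := 4 * graph_bound * n2).
  assert (Hw : 0 < w) by (unfold w; nra).
  assert (Hgw : forall s, 0 <= s -> graph_energy (X s) <= w).
  { intros s Hs. destruct (HX s Hs) as [Hxs [Hgs _]].
    destruct (graph_energy_le (X s) Hxs Hgs) as [_ [H1 _]].
    eapply Rle_trans; [exact H1|].
    pose proof (energy_gen_bound om gam c c_l2 gam_pos X s HX Hs) as H2. fold n2 in H2.
    apply Rle_trans with (graph_bound * (4 * n2)); [apply Rmult_le_compat_l; lra|].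
    unfold w; lra. }
  set (delta := / 2 * energy (X t)).
  assert (Hdelta : 0 < delta) by (unfold delta; lra).
  set (g := Rpower (delta / (4 * w)) (- (alpha / 2))).
  assert (Hg : 0 < g) by apply Rpower_pos.
  assert (HEpos : 0 < energy (X 0)) by lra.
  assert (Hden : 0 < 6 * eta * energy (X 0) * g) by (repeat apply Rmult_lt_0_compat; lra).
  (* The threshold is the condition of [power_decay] on [rho], solved for the tail with
     [rho = 3 * eta * (ctail n * energy (X 0))]. *)
  destruct (Series_tail_small (fun j => c j ^ 2) (a * delta / (6 * eta * energy (X 0) * g)) c_l2)
    as [n Hn]; [apply Rdiv_lt_0_compat; [now apply Rmult_lt_0_compat|easy]|].
  fold (ctail n) in Hn. pose proof (ctail_nonneg n) as Hct.
  assert (Hb : forall s, 0 <= s -> / 2 * energy (X s) <= lyapunov eta n (X s) <= 2 * energy (X s))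
    by (intros s Hs; apply lyapunov_bounds; auto).
  (* The reference value [4 * w] matches the [2 * w] of [weighted_lower], because the functional is
     at most twice the energy. *)
  assert (Hdec : lyapunov eta n (X t) <=
    4 * w * Rpower (mu * (t + 1)) (- (2 / alpha))).
  { apply power_decay with (F := fun s => lyapunov eta n (X s))
      (dF := fun s => lyapunov_rate eta n (X s))
      (rho := 3 * eta * (ctail n * energy (X 0))) (delta := delta); try easy.
    - lra.
    - repeat apply Rmult_le_pos; lra.
    - intros s Hs. apply lyapunov_derive; [easy|lra].
    - intros s Hs. unfold delta. specialize (HE s Hs). specialize (Hb s (proj1 Hs)). lra.
    - specialize (Hb 0 H00). unfold w. lra.
    - intros s Hs. specialize (HE s Hs). specialize (Hb s (proj1 Hs)).
      assert (Hs0 : 0 <= s) by lra. destruct (HX s Hs0) as [Hxs [Hgs _]].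
      destruct (graph_energy_le (X s) Hxs Hgs) as [Hgex _].
      eapply Rle_trans; [now apply lyapunov_rate_le|].
      assert (HEs : 0 < energy (X s)) by lra.
      pose proof (weighted_lower (X s) w Hxs Hgex Hw (Hgw s Hs0) HEs) as Hwl.
      set (F := lyapunov eta n (X s)) in *.
      assert (Hpw : Rpower (F / (4 * w)) (alpha / 2) * F <=
          2 * (Rpower (energy (X s) / (2 * w)) (alpha / 2) * energy (X s))).
      { replace (2 * (Rpower (energy (X s) / (2 * w)) (alpha / 2) * energy (X s)))
          with (Rpower (energy (X s) / (2 * w)) (alpha / 2) * (2 * energy (X s))) by ring.
        apply Rmult_le_compat; try lra; [apply Rlt_le, Rpower_pos|].
        apply Rle_Rpower_l; [lra|]. split; [apply Rdiv_lt_0_compat; lra|].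
        replace (energy (X s) / (2 * w)) with (2 * energy (X s) / (4 * w)) by (field; lra).
        apply Rmult_le_compat_r; [apply Rlt_le, Rinv_0_lt_compat; lra|lra]. }
      assert (H1 : eta / 4 * (b / 2 * Rpower (energy (X s) / (2 * w)) (alpha / 2) * energy (X s))
          <= eta / 4 * weighted (X s)) by (apply Rmult_le_compat_l; lra).
      assert (H2 : a * (Rpower (F / (4 * w)) (alpha / 2) * F) <=
          a * (2 * (Rpower (energy (X s) / (2 * w)) (alpha / 2) * energy (X s))))
        by (apply Rmult_le_compat_l; lra).
      assert (H3 : 3 * eta * (ctail n * energy (X s)) <= 3 * eta * (ctail n * energy (X 0)))
        by (apply Rmult_le_compat_l; [lra|apply Rmult_le_compat_l; lra]).
      unfold a in *. lra.
    - fold g.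
      replace (3 * eta * (ctail n * energy (X 0)) * g)
        with (ctail n * (6 * eta * energy (X 0) * g) / 2) by field.
      assert (H1 : ctail n * (6 * eta * energy (X 0) * g) <=
        a * delta / (6 * eta * energy (X 0) * g) * (6 * eta * energy (X 0) * g))
        by (apply Rmult_le_compat_r; lra).
      replace (a * delta / (6 * eta * energy (X 0) * g) * (6 * eta * energy (X 0) * g))
        with (a * delta) in H1 by (field; repeat split; lra).
      lra. }
  rewrite <- Rpower_mult_distr in Hdec by lra.
  pose proof (proj1 (Hb t Ht)) as Hbt.
  apply Rle_trans with (2 * (4 * w * (Rpower mu (- (2 / alpha)) * Rpower (t + 1) (- (2 / alpha)))));
    [lra|].
  unfold w. right; ring.
Qed.

End Lyapunov.

(** * Reduction of the complex system to two real ones *)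

(* With [a = q + p] and [b = -i (q - p)] the system has real coefficients, so the real parts
   ([im = false]) and the imaginary parts ([im = true]) of [(a, b)] evolve independently. *)
Definition real_coords (im : bool) (z : C * C) : R * R :=
  if im then (Im (fst z) + Im (snd z), Re (snd z) - Re (fst z))
  else (Re (fst z) + Re (snd z), Im (fst z) - Im (snd z)).

Definition realify (im : bool) (e : Hvec) : rstate := fun j => real_coords im (e j).

Lemma Cmod_sqr (z : C) : Cmod z ^ 2 = Re z ^ 2 + Im z ^ 2.
Proof.
  unfold Cmod. rewrite pow2_sqrt; [easy|].
  pose proof (pow2_ge_0 (fst z)). pose proof (pow2_ge_0 (snd z)). lra.
Qed.

(** The parallelogram law for [q + p] and [q - p], split into real and imaginary parts. *)
Lemma sqn_real_coords (z : C * C) :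
  Cmod (fst z) ^ 2 + Cmod (snd z) ^ 2 =
  / 2 * (sqn (real_coords false z) + sqn (real_coords true z)).
Proof. rewrite !Cmod_sqr. unfold sqn, real_coords; cbn [fst snd]. field. Qed.

Lemma sqn_real_coords_le (im : bool) (z : C * C) :
  sqn (real_coords im z) <= 2 * (Cmod (fst z) ^ 2 + Cmod (snd z) ^ 2).
Proof.
  rewrite sqn_real_coords.
  pose proof (sqn_nonneg (real_coords false z)). pose proof (sqn_nonneg (real_coords true z)).
  destruct im; lra.
Qed.

Lemma finite_energy_realify (im : bool) (e : Hvec) : inH e -> finite_energy (realify im e).
Proof.
  intros [Hq Hp].
  apply ex_series_dominated with (fun j => 2 * (Cmod (fst (e j)) ^ 2 + Cmod (snd (e j)) ^ 2)).
  - intros j. rewrite Rabs_pos_eq by apply sqn_nonneg. apply sqn_real_coords_le.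
  - apply ex_series_Rscal, ex_series_Rplus; assumption.
Qed.

Lemma normH_sqr (e : Hvec) : (forall im, finite_energy (realify im e)) ->
  normH e ^ 2 = / 2 * (energy (realify false e) + energy (realify true e)).
Proof.
  intros Hf. unfold energy. rewrite <- Series_plus, <- Series_scal_l by apply Hf.
  unfold normH. rewrite pow2_sqrt.
  - apply Series_ext. intros j. apply sqn_real_coords.
  - apply Series_nonneg.
    + intros j. pose proof (pow2_ge_0 (Cmod (fst (e j)))). pose proof (pow2_ge_0 (Cmod (snd (e j)))).
      lra.
    + apply ex_series_ext with (2 := ex_series_Rscal (/ 2) _
        (ex_series_Rplus _ _ (Hf false) (Hf true))).
      intros j. symmetry. apply sqn_real_coords.
Qed.

Lemma in_l2_Re_Im (u : nat -> C) : in_l2 u ->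
  ex_series (fun j => Re (u j) ^ 2) /\ ex_series (fun j => Im (u j) ^ 2).
Proof.
  intros Hu.
  split; apply ex_series_dominated with (2 := Hu); intros j;
    rewrite Rabs_pos_eq by apply pow2_ge_0; rewrite Cmod_sqr;
    pose proof (pow2_ge_0 (Re (u j))); pose proof (pow2_ge_0 (Im (u j))); lra.
Qed.

Lemma CSeries_real_scal (c : nat -> R) (u : nat -> C) :
  CSeries (fun j => Cmult (RtoC (c j)) (u j)) =
  (Series (fun j => c j * Re (u j)), Series (fun j => c j * Im (u j))).
Proof.
  unfold CSeries. f_equal; apply Series_ext; intros j; unfold Re, Im, Cmult, RtoC; simpl; ring.
Qed.

Section Reduction.

Variables (om : nat -> R) (gam : R) (c : nat -> R).
Hypothesis c_l2 : ex_series (fun j => c j ^ 2).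

(** Both rows of [Aop] contain the same damping term: it doubles in [q + p], turning [gam / 2] into
    [gam], and cancels in [q - p]. *)
Lemma realify_Aop (im : bool) (e : Hvec) (j : nat) : inH e ->
  realify im (Aop om gam c e) j = gen om gam c (realify im e) j.
Proof.
  intros [Hq Hp].
  destruct (in_l2_Re_Im _ Hq) as [Hq1 Hq2]. destruct (in_l2_Re_Im _ Hp) as [Hp1 Hp2].
  assert (Hout : out c (realify im e) =
    if im then Series (fun j => c j * Im (qpart e j)) + Series (fun j => c j * Im (ppart e j))
    else Series (fun j => c j * Re (qpart e j)) + Series (fun j => c j * Re (ppart e j))).
  { unfold out. destruct im; rewrite <- Series_plus by (now apply ex_series_mult_l2);
      apply Series_ext; intros k; unfold realify, real_coords, qpart, ppart; simpl; ring. }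
  unfold gen. rewrite Hout. unfold realify at 1. unfold real_coords, Aop, checkA.
  rewrite !CSeries_real_scal.
  destruct im; unfold realify, real_coords, qpart, ppart;
    unfold Re, Im, Cmult, Cplus, Copp, Ci, RtoC; simpl; f_equal; field.
Qed.

Lemma finite_energy_gen (x : rstate) :
  ex_series (fun j => om j ^ 2 * sqn (x j)) -> finite_energy (gen om gam c x).
Proof.
  intros Hx. unfold finite_energy.
  apply ex_series_dominated with
    (fun j => 2 * (om j ^ 2 * sqn (x j)) + 2 * gam ^ 2 * out c x ^ 2 * c j ^ 2).
  - intros j. rewrite Rabs_pos_eq by apply sqn_nonneg. unfold sqn, gen; cbn [fst snd].
    pose proof (pow2_ge_0 (om j * snd (x j) + gam * c j * out c x)).
    pose proof (pow2_ge_0 (om j * fst (x j))). nra.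
  - apply ex_series_Rplus; apply ex_series_Rscal; assumption.
Qed.

Lemma finite_energy_gen_realify (im : bool) (e : Hvec) : inDA om e ->
  finite_energy (gen om gam c (realify im e)).
Proof.
  intros [_ He]. apply finite_energy_gen.
  apply ex_series_dominated with
    (fun j => 2 * (om j ^ 2 * (Cmod (fst (e j)) ^ 2 + Cmod (snd (e j)) ^ 2))).
  - intros j. pose proof (pow2_ge_0 (om j)).
    rewrite Rabs_pos_eq by (apply Rmult_le_pos; [easy|apply sqn_nonneg]).
    pose proof (Rmult_le_compat_l _ _ _ H (sqn_real_coords_le im (e j))). unfold realify. lra.
  - now apply ex_series_Rscal.
Qed.

(** * From one-sided to two-sided derivatives at time 0 *)

(** The continuation to negative times is affine with slope [v], so the left difference quotient at
    0 equals [v] exactly. *)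
Definition extend (X : R -> rstate) (v : rstate) : R -> rstate :=
  fun t => if Rlt_dec t 0 then comb 1 (X 0) t v else X t.

Lemma extend_nonneg (X : R -> rstate) (v : rstate) (t : R) : 0 <= t -> extend X v t = X t.
Proof. intros Ht. unfold extend. destruct (Rlt_dec t 0); [lra|easy]. Qed.

Lemma trajectory_extend (X : R -> rstate) :
  (forall t, 0 <= t -> finite_energy (X t) /\ finite_energy (gen om gam c (X t)) /\
    forall e, 0 < e -> exists delta, 0 < delta /\
      forall h, h <> 0 -> Rabs h < delta -> 0 <= t + h ->
        energy (quotient_error X (gen om gam c (X t)) t h) < e) ->
  trajectory om gam c (extend X (gen om gam c (X 0))).
Proof.
  intros HX t Ht. rewrite (extend_nonneg X _ t) by easy.
  destruct (HX t Ht) as [Hx [Hv HD]]. split; [easy|split; [easy|]].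
  intros e He. destruct (HD e He) as [d [Hd HDd]].
  (* For [t > 0] this keeps [t + h] positive, so negative times are met only at [t = 0]. *)
  set (d0 := if Req_dec_T t 0 then 1 else t).
  assert (Hd0 : 0 < d0) by (unfold d0; destruct (Req_dec_T t 0); lra).
  exists (Rmin d d0). split; [now apply Rmin_glb_lt|].
  intros h Hh Hlt.
  assert (Hhd : Rabs h < d) by (apply Rlt_le_trans with (1 := Hlt), Rmin_l).
  assert (Hhd0 : Rabs h < d0) by (apply Rlt_le_trans with (1 := Hlt), Rmin_r).
  destruct (Rle_lt_dec 0 (t + h)) as [Hth|Hth].
  - rewrite extend_nonneg by easy. split; [now apply HX|].
    unfold quotient_error. rewrite !extend_nonneg by easy. now apply HDd.
  - assert (Ht0 : t = 0).
    { unfold d0 in Hhd0. destruct (Req_dec_T t 0) as [E|_]; [easy|].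
      apply Rabs_def2 in Hhd0. lra. }
    assert (Hext : extend X (gen om gam c (X 0)) (t + h) = comb 1 (X t) h (gen om gam c (X t))).
    { unfold extend. destruct (Rlt_dec (t + h) 0); [|lra].
      subst t. now rewrite Rplus_0_l. }
    split; [rewrite Hext; now apply finite_energy_comb|].
    replace (energy _) with 0; [easy|].
    transitivity (Series (fun _ => 0 * 0)); [rewrite Series_scal_l; ring|].
    apply Series_ext. intros j.
    unfold quotient_error. rewrite Hext, extend_nonneg by easy.
    unfold sqn, comb; cbn [fst snd]. field. easy.
Qed.

Lemma realify_quotient (im : bool) (eps : R -> Hvec) (t h : R) (j : nat) : inH (eps t) ->
  quotient_error (fun s => realify im (eps s)) (gen om gam c (realify im (eps t))) t h j =
  realify im (Hsub (Hscal (/ h) (Hsub (eps (t + h)) (eps t))) (Aop om gam c (eps t))) j.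
Proof.
  intros He. unfold quotient_error. unfold comb at 1. rewrite <- realify_Aop by easy.
  unfold realify, real_coords, comb, Hsub, Hscal. destruct im;
    unfold Re, Im, Cminus, Cmult, Cplus, Copp, RtoC; cbn [fst snd]; f_equal; ring.
Qed.

Lemma realify_trajectory (im : bool) (eps : R -> Hvec) : is_solution om gam c eps ->
  trajectory om gam c
    (extend (fun t => realify im (eps t)) (gen om gam c (realify im (eps 0)))).
Proof.
  intros Hs. apply trajectory_extend. intros t Ht.
  destruct (Hs t Ht) as [Hin HD]. pose proof (proj1 Hin) as HinH.
  split; [now apply finite_energy_realify|].
  split; [now apply finite_energy_gen_realify|].
  intros e He.
  (* Each of the two real energies is at most twice the square of [normH]. *)
  destruct (HD (sqrt (e / 2))) as [d [Hd HDd]]; [apply sqrt_lt_R0; lra|].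
  exists d. split; [easy|]. intros h Hh Hlt Hth.
  specialize (HDd h Hh Hlt Hth). destruct (Hs (t + h) Hth) as [[HinH' _] _].
  set (z := Hsub (Hscal (/ h) (Hsub (eps (t + h)) (eps t))) (Aop om gam c (eps t))) in *.
  (* [Series] has a default value on divergent series, so a small [normH z] is informative only once
     the summability of [z] is known. *)
  assert (Hz : forall i, finite_energy (realify i z)).
  { intros i.
    apply finite_energy_ext with (1 := fun j => realify_quotient i eps t h j HinH).
    apply finite_energy_quotient_error; try now apply finite_energy_realify.
    now apply finite_energy_gen_realify. }
  rewrite (energy_ext _ _ (fun j => realify_quotient im eps t h j HinH)). fold z.
  assert (Hn : normH z ^ 2 < e / 2).
  { rewrite <- (pow2_sqrt (e / 2)) by lra.
    pose proof (sqrt_pos (Series (fun j => Cmod (fst (z j)) ^ 2 + Cmod (snd (z j)) ^ 2))) as Hp.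
    fold (normH z) in Hp. nra. }
  rewrite normH_sqr in Hn by easy.
  pose proof (energy_nonneg _ (Hz false)). pose proof (energy_nonneg _ (Hz true)).
  destruct im; lra.
Qed.

End Reduction.

(** * Lower bound for all coefficients and the decay estimate *)

Lemma positive_lower_bound (f : nat -> R) (k : nat) : (forall j, 0 < f j) ->
  forall m, 0 < m -> (forall j, (k <= j)%nat -> m <= f j) ->
  exists b, 0 < b /\ forall j, b <= f j.
Proof.
  intros Hf. induction k as [|k IH]; intros m Hm H.
  - exists m. split; [easy|]. intros j. apply H. lia.
  - apply (IH (Rmin m (f k))); [now apply Rmin_glb_lt|].
    intros j Hj. destruct (Nat.eq_dec j k) as [->|Hne]; [apply Rmin_r|].
    apply Rle_trans with m; [apply Rmin_l|apply H; lia].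
Qed.

(** From [k0] on, squaring the assumption gives [beta ^ 2]; the finitely many earlier values are
    positive because no [c j] vanishes. *)
Lemma coefficient_lower_bound (om c : nat -> R) (alpha beta : R) (k0 : nat) :
  0 < beta -> (forall j, c j <> 0) ->
  (forall k, (k0 <= k)%nat -> Rabs (c k) * Rpower (om k) (alpha / 2) >= beta) ->
  exists b, 0 < b /\ forall j, b <= c j ^ 2 * Rpower (om j) alpha.
Proof.
  intros Hbeta Hc H.
  apply (positive_lower_bound _ k0) with (beta ^ 2).
  - intros j. apply Rmult_lt_0_compat; [now apply pow2_gt_0|apply Rpower_pos].
  - now apply pow_lt.
  - intros j Hj. specialize (H j Hj).
    replace (c j ^ 2 * Rpower (om j) alpha) with ((Rabs (c j) * Rpower (om j) (alpha / 2)) ^ 2).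
    + apply pow_incr. lra.
    + rewrite Rpow_mult_distr, pow2_abs. f_equal.
      replace alpha with (alpha / 2 + alpha / 2) at 2 by field.
      rewrite Rpower_plus. ring.
Qed.

Theorem theorem2p1
  (om : nat -> R) (c : nat -> R) (gam : R)
  (Hom_pos : forall j, 0 < om j)
  (Hc_l2 : ex_series (fun j => c j ^ 2))
  (Hgam : 0 < gam)
  (* (A1) *)
  (HA1_incr : forall j, om j < om (S j))
  (HA1_c : forall j, c j <> 0)
  (* (A2) *)
  (kappa : R) (Hkappa : 0 < kappa)
  (HA2 : forall j, om (S j) - om j >= kappa)
  (* (A3) *)
  (alpha beta : R) (k0 : nat) (Halpha : 0 < alpha) (Hbeta : 0 < beta)
  (HA3 : forall k, (k0 <= k)%nat -> Rabs (c k) * Rpower (om k) (alpha / 2) >= beta) :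
  exists beta_t : R, beta_t >= beta /\
    forall eps : R -> Hvec,
      is_solution om gam c eps -> inDA om (eps 0) ->
      forall t, 0 <= t ->
        normH (eps t) <= beta_t * Rpower (t + 1) (- (1 / alpha)) * normH (Aop om gam c (eps 0)).
Proof.
  destruct (coefficient_lower_bound om c alpha beta k0 Hbeta HA1_c HA3) as [b [Hb Hcb]].
  destruct (trajectory_decay om gam c kappa Hom_pos Hc_l2 Hgam Hkappa HA2 alpha b Halpha Hb Hcb)
    as [K [HK Hdecay]].
  (* The root appears because energies are squared norms; the maximum secures [beta_t >= beta]. *)
  exists (Rmax beta (sqrt K)). split; [apply Rle_ge, Rmax_l|].
  intros eps Hs H0 t Ht.
  set (r := Rpower (t + 1) (- (1 / alpha))).
  assert (Hr : 0 < r) by apply Rpower_pos.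
  assert (Hr2 : Rpower (t + 1) (- (2 / alpha)) = r ^ 2).
  { unfold r. simpl. rewrite Rmult_1_r, <- Rpower_plus. f_equal. field. lra. }
  pose proof (proj1 (proj1 (Hs t Ht))) as HinH. pose proof (proj1 H0) as HinH0.
  assert (HfA : forall im, finite_energy (realify im (Aop om gam c (eps 0)))).
  { intros im. apply finite_energy_ext with (gen om gam c (realify im (eps 0))).
    - intros j. symmetry. now apply realify_Aop.
    - now apply finite_energy_gen_realify. }
  assert (HE : forall im, energy (realify im (eps t)) <=
    K * r ^ 2 * energy (realify im (Aop om gam c (eps 0)))).
  { intros im.
    pose proof (Hdecay _ (realify_trajectory om gam c Hc_l2 im eps Hs) t Ht) as H.
    rewrite !extend_nonneg, Hr2 in H by lra.
    rewrite (energy_ext (realify im (Aop om gam c (eps 0))) (gen om gam c (realify im (eps 0))));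
      [easy|].
    intros j. now apply realify_Aop. }
  assert (HnA : 0 <= normH (Aop om gam c (eps 0))) by apply sqrt_pos.
  (* By [normH_sqr] this is the average of the two real estimates. *)
  assert (Hsq : normH (eps t) ^ 2 <= (sqrt K * r * normH (Aop om gam c (eps 0))) ^ 2).
  { rewrite !Rpow_mult_distr, pow2_sqrt, !normH_sqr
      by (lra || easy || (intros im; now apply finite_energy_realify)).
    pose proof (HE false). pose proof (HE true). lra. }
  apply Rle_trans with (sqrt K * r * normH (Aop om gam c (eps 0))).
  - apply Rsqr_incr_0_var; [rewrite !Rsqr_pow2; easy|].
    apply Rmult_le_pos; [apply Rmult_le_pos; [apply sqrt_pos|lra]|easy].
  - apply Rmult_le_compat_r; [easy|]. apply Rmult_le_compat_r; [lra|apply Rmax_r].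
Qed.
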